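(* Let $r\ge2$ be an integer. (1) For $x\in\mathbb C$ with $\operatorname{Im}(x)<0$, $$\mathcal C_r\left(\frac x{2}\right)=\exp\left(-\frac{(r-1)!}{(2\pi i)^{r-1}}\sum_{k=0}^{r-1}\frac{(\pi i)^k}{k!}\operatorname{Li}_{r-k}(-e^{-\pi ix})x^k+\frac{\pi i}{r}\left(\frac x2\right)^{r}-\frac{(r-1)!}{(2\pi i)^{r-1}}\zeta_E(r)\right).$$ (2) For $x\in\mathbb C$ with $\operatorname{Im}(x)>0$, $$\mathcal C_r\left(\frac x{2}\right)=\exp\left(-\frac{(r-1)!}{(-2\pi i)^{r-1}}\sum_{k=0}^{r-1}\frac{(-\pi i)^k}{k!}\operatorname{Li}_{r-k}(-e^{\pi ix})x^k-\frac{\pi i}{r}\left(\frac x2\right)^{r}-\frac{(r-1)!}{(-2\pi i)^{r-1}}\zeta_E(r)\right).$$ (3) If $r$ is even and $0\le x<1$ is real, then $$ \begin{aligned} \mathcal C_r\left(\frac x{2}\right)&=\left(2\cos\frac{\pi x}{2}\right)^{(\frac x2)^{r-1}} \exp\biggl((-1)^{\frac{r}{2}}\frac{(r-1)!}{(2\pi)^{r-1}}\sum_{\substack{1\leq k\leq r-3 \\ k\ \text{odd}}}\frac{(-1)^{\frac{k-1}2}(\pi x)^k}{k!}\sum_{n=1}^\infty \frac{(-1)^n\cos(\pi nx)}{n^{r-k}} \\ &\qquad-(-1)^{\frac{r}{2}}\frac{(r-1)!}{(2\pi)^{r-1}}\sum_{\substack{0\leq k\leq r-2 \\ k\ \text{even}}}\frac{(-1)^{\frac{k}2}(\pi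 x)^k}{k!}\sum_{n=1}^\infty \frac{(-1)^n\sin(\pi nx)}{n^{r-k}} \biggr). \end{aligned} $$ (4) If $r\ge3$ is odd and $0\le x<1$ is real, then $$ \begin{aligned} \mathcal C_r\left(\frac x{2}\right)&=\left(2\cos\frac{\pi x}{2}\right)^{(\frac x2)^{r-1}} \exp\biggl(-(-1)^{\frac{r-1}{2}}\frac{(r-1)!}{(2\pi)^{r-1}}\sum_{\substack{0\leq k\leq r-3 \\ k\ \text{even}}}\frac{(-1)^{\frac k2}(\pi x)^k}{k!}\sum_{n=1}^\infty \frac{(-1)^n\cos(\pi nx)}{n^{r-k}} \\ &\qquad-(-1)^{\frac{r-1}{2}}\frac{(r-1)!}{(2\pi)^{r-1}}\sum_{\substack{1\leq k\leq r-2 \\ k\ \text{odd}}}\frac{(-1)^{\frac{k-1}2}(\pi x)^k}{k!}\sum_{n=1}^\infty \frac{(-1)^n\sin(\pi nx)}{n^{r-k}} \\ &\qquad -(-1)^{\frac{r-1}2}\frac{(r-1)!}{(2\pi)^{r-1}}\zeta_E(r)\biggr). \end{aligned} $$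
   Context: For an integer $r\ge2$ let $P_r(y)=(1-y)\exp\left(y+\frac{y^2}{2}+\cdots+\frac{y^r}{r}\right)$. The multiple cosine function of Kurokawa–Koyama of order $r\ge2$ is $\mathcal C_r(x)=\prod_{n\ge1,\ n\text{ odd}}\left\{P_r\left(\frac{x}{n/2}\right)P_r\left(-\frac{x}{n/2}\right)^{(-1)^{r-1}}\right\}^{(n/2)^{r-1}}$, interpreted as $\mathcal C_r(x)=\exp\Big(\sum_{n\ge1,\,n\text{ odd}}(n/2)^{r-1}\big[\operatorname{Log}P_r(2x/n)+(-1)^{r-1}\operatorname{Log}P_r(-2x/n)\big]\Big)$, where $\operatorname{Log}P_r(y):=\operatorname{Log}(1-y)+y+\frac{y^2}{2}+\cdots+\frac{y^r}{r}$ with $\operatorname{Log}$ the principal branch. The series converges and defines a holomorphic function on $D=\mathbb C\setminus\big((-\infty,-\tfrac12]\cup[\tfrac12,\infty)\big)$ (which contains all non-real $x$), positive on $(-\tfrac12,\tfrac12)$. $\operatorname{Li}_k(z)=\sum_{n\ge1}z^n/n^k$ for $|z|<1$ is the polylogarithm, $\zeta_E(s)=\sum_{n=1}^\infty\frac{(-1)^{n+1}}{n^s}$. Empty sums are $0$. *)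

(* Defs.v *)
From Stdlib Require Import Reals.
From Coquelicot Require Import Coquelicot.
Open Scope R_scope.

Fixpoint Cpow (z : C) (n : nat) : C :=
  match n with O => RtoC 1 | S m => Cmult z (Cpow z m) end.

Fixpoint Csum (f : nat -> C) (n : nat) : C :=
  match n with O => RtoC 0 | S m => Cplus (Csum f m) (f m) end.

Fixpoint Rsum (f : nat -> R) (n : nat) : R :=
  match n with O => 0 | S m => Rsum f m + f m end.

Definition CSeries (a : nat -> C) : C :=
  (Series (fun n => Re (a n)), Series (fun n => Im (a n))).

Definition Cexp (z : C) : C :=
  (exp (Re z) * cos (Im z), exp (Re z) * sin (Im z)).

(* principal argument, with values in (-PI, PI] *)
Definition Carg (z : C) : R :=
  let x := Re z in let y := Im z in
  if Rlt_dec 0 x then atan (y / x)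
  else if Rlt_dec x 0 then
         (if Rle_dec 0 y then atan (y / x) + PI else atan (y / x) - PI)
  else if Rlt_dec 0 y then PI / 2
  else if Rlt_dec y 0 then - (PI / 2)
  else 0.

Definition CLog (z : C) : C := (ln (Cmod z), Carg z).

Definition LogP (r : nat) (y : C) : C :=
  Cplus (CLog (Cminus (RtoC 1) y))
        (Csum (fun j => Cdiv (Cpow y (S j)) (RtoC (INR (S j)))) r).

(* Kurokawa–Koyama multiple cosine C_r(x); odd n written n = 2m+1 *)
Definition multicos (r : nat) (x : C) : C :=
  Cexp (CSeries (fun m =>
    let n := INR (2 * m + 1) in
    Cmult (RtoC ((n / 2) ^ (r - 1)))
      (Cplus (LogP r (Cdiv (Cmult (RtoC 2) x) (RtoC n)))
             (Cmult (RtoC ((-1) ^ (r - 1)))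
                    (LogP r (Copp (Cdiv (Cmult (RtoC 2) x) (RtoC n)))))))).

Definition Li (k : nat) (z : C) : C :=
  CSeries (fun n => Cdiv (Cpow z (S n)) (RtoC (INR (S n) ^ k))).

Definition zetaE (s : nat) : R :=
  Series (fun n => (-1) ^ n / INR (S n) ^ s).

(* Main.v *)
(** With [z = x / 2], the logarithm of the cosine product has derivative
    [- pi z^(r-1) tan (pi z)].  Replacing [tan] by its expansion in powers of
    [exp (- 2 pi i z)], valid in the lower half-plane, the right-hand side of (1)
    has the same derivative, because the derivative of the sum over [k] telescopes
    to [Li_0].  Both sides are compared along the segment from [0] to [x].  Only
    finite sums are ever differentiated: the mean value inequality bounds the
    difference between the [N]-th partial sum of the logarithm of the product and
    the closed form by [c / N], uniformly for bounded [x] in the lower half-plane, and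
    this bound survives the passage to the real axis, which gives (3) and (4) after
    taking real parts.  Part (2) follows from (1) by the parity of each factor.

    The expansion [2 z sum 1 / (a^2 - z^2) = pi tan (pi z)] over half-odd [a]
    is obtained by iterating the duplication formula of the Poisson kernel, which
    writes the tangent as a finite sum over [2^m] angles, and letting [m] tend to
    infinity under the majorant [1 / a^2]. *)

Require Import Defs.
From Stdlib Require Import Reals Arith Lra Lia Psatz.
From Coquelicot Require Import Coquelicot.
Open Scope R_scope.

(** * Limits and derivatives of complex-valued functions *)

(** Convergence of the product is not established beforehand: the bound [c / N] gives convergence
    and value at once. The obstacle is the starting point of the segment. At [0] the argument of the
    polylogarithms is [-1], on the unit circle, so the truncation error of [Li_0], a geometric tail,
    is uniform only on [[d, 1]] with [d > 0]. Hence two nested limits: the truncation order [M]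
    grows at fixed [d], which removes the tail and with it the dependence on [d]; then [d] tends to
    [0]. For the second limit the closed form has to be continuous up to the circle. For [Li_k] with
    [k >= 2] dominated convergence does this, while the series of [Li_1] has no summable majorant
    there. A real [x] is approached with [N] fixed, so no limit is ever interchanged with the
    infinite product. The lower half-plane is used because there [exp (- 2 pi i z)] and its roots
    lie in the open unit disc, away from all poles of the Poisson kernel. *)

Definition Clim {T : Type} (F : (T -> Prop) -> Prop) (f : T -> C) (l : C) : Prop :=
  filterlim (fun t => Re (f t)) F (locally (Re l)) /\
  filterlim (fun t => Im (f t)) F (locally (Im l)).

(** A derivative in a real parameter suffices, because the two sides are compared along segments
    [s * x]. *)
Definition Cder (f : R -> C) (t : R) (l : C) : Prop :=
  is_derive (fun s => Re (f s)) t (Re l) /\ is_derive (fun s => Im (f s)) t (Im l).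

Section Limits.

Context {T : Type} {F : (T -> Prop) -> Prop} {FF : Filter F}.

Lemma filterlim_Rplus (f g : T -> R) (a b : R) :
  filterlim f F (locally a) -> filterlim g F (locally b) ->
  filterlim (fun t => f t + g t) F (locally (a + b)).
Proof.
intros Hf Hg; apply (filterlim_comp_2 f g Rplus Hf Hg).
exact (@filterlim_plus R_AbsRing R_NormedModule a b).
Qed.

Lemma filterlim_Rmult (f g : T -> R) (a b : R) :
  filterlim f F (locally a) -> filterlim g F (locally b) ->
  filterlim (fun t => f t * g t) F (locally (a * b)).
Proof.
intros Hf Hg; apply (filterlim_comp_2 f g Rmult Hf Hg).
exact (@filterlim_mult R_AbsRing a b).
Qed.

Lemma filterlim_Ropp (f : T -> R) (a : R) :
  filterlim f F (locally a) -> filterlim (fun t => - f t) F (locally (- a)).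
Proof.
intros Hf; apply (filterlim_comp _ _ _ f Ropp F (locally a) _ Hf).
exact (@filterlim_opp R_AbsRing R_NormedModule a).
Qed.

Lemma filterlim_Rcomp (h : R -> R) (f : T -> R) (a : R) :
  continuous h a -> filterlim f F (locally a) ->
  filterlim (fun t => h (f t)) F (locally (h a)).
Proof. intros Hh Hf; exact (filterlim_comp _ _ _ f h F (locally a) _ Hf Hh). Qed.

Lemma Clim_const (c : C) : Clim F (fun _ => c) c.
Proof. split; apply filterlim_const. Qed.

Lemma Clim_plus (f g : T -> C) (a b : C) :
  Clim F f a -> Clim F g b -> Clim F (fun t => f t + g t)%C (a + b)%C.
Proof. intros [H1 H2] [H3 H4]; split; simpl; apply filterlim_Rplus; assumption. Qed.

Lemma Clim_opp (f : T -> C) (a : C) : Clim F f a -> Clim F (fun t => - f t)%C (- a)%C.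
Proof. intros [H1 H2]; split; simpl; apply filterlim_Ropp; assumption. Qed.

Lemma Clim_minus (f g : T -> C) (a b : C) :
  Clim F f a -> Clim F g b -> Clim F (fun t => f t - g t)%C (a - b)%C.
Proof. intros Hf Hg; apply Clim_plus; [| apply Clim_opp]; assumption. Qed.

Lemma Clim_mult (f g : T -> C) (a b : C) :
  Clim F f a -> Clim F g b -> Clim F (fun t => f t * g t)%C (a * b)%C.
Proof.
intros [H1 H2] [H3 H4]; split; simpl.
- apply filterlim_Rplus; [| apply filterlim_Ropp]; apply filterlim_Rmult; assumption.
- apply filterlim_Rplus; apply filterlim_Rmult; assumption.
Qed.

Lemma Clim_RtoC (f : T -> R) (a : R) :
  filterlim f F (locally a) -> Clim F (fun t => RtoC (f t)) (RtoC a).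
Proof. intros H; split; [exact H | apply filterlim_const]. Qed.

Lemma Clim_ext_loc (f g : T -> C) (a : C) :
  F (fun t => f t = g t) -> Clim F f a -> Clim F g a.
Proof.
intros E [H1 H2]; split.
- refine (filterlim_ext_loc _ _ _ H1); revert E; apply filter_imp; intros t ->; reflexivity.
- refine (filterlim_ext_loc _ _ _ H2); revert E; apply filter_imp; intros t ->; reflexivity.
Qed.

Lemma Clim_ext (f g : T -> C) (a : C) : (forall t, f t = g t) -> Clim F f a -> Clim F g a.
Proof. intros E; apply Clim_ext_loc, filter_forall, E. Qed.

Lemma Clim_pow (f : T -> C) (a : C) (n : nat) :
  Clim F f a -> Clim F (fun t => Cpow (f t) n) (Cpow a n).
Proof.
intros H; induction n as [|n IH]; simpl.
- apply Clim_const.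
- apply Clim_mult; assumption.
Qed.

Lemma Clim_sum (f : T -> nat -> C) (a : nat -> C) (n : nat) :
  (forall k, (k < n)%nat -> Clim F (fun t => f t k) (a k)) ->
  Clim F (fun t => Csum (f t) n) (Csum a n).
Proof.
induction n as [|n IH]; intros H; simpl.
- apply Clim_const.
- apply Clim_plus; [apply IH; intros; apply H; lia | apply H; lia].
Qed.

Lemma Clim_inv (f : T -> C) (a : C) :
  a <> 0 -> Clim F f a -> Clim F (fun t => / f t)%C (/ a)%C.
Proof.
intros Ha [H1 H2].
assert (Hn : fst a ^ 2 + snd a ^ 2 <> 0).
{ intros E; apply Ha; destruct a as [u v]; simpl in E.
  assert (u = 0) by nra; assert (v = 0) by nra; subst; reflexivity. }
assert (HN : filterlim (fun t => / (fst (f t) ^ 2 + snd (f t) ^ 2)) F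
               (locally (/ (fst a ^ 2 + snd a ^ 2)))).
{ apply (filterlim_Rcomp Rinv); [apply continuous_Rinv; exact Hn |].
  simpl; apply filterlim_Rplus; repeat apply filterlim_Rmult;
    try apply filterlim_const; assumption. }
split; simpl; apply filterlim_Rmult; try exact HN; [exact H1 | apply filterlim_Ropp; exact H2].
Qed.

Lemma Clim_div (f g : T -> C) (a b : C) :
  b <> 0 -> Clim F f a -> Clim F g b -> Clim F (fun t => f t / g t)%C (a / b)%C.
Proof. intros; apply Clim_mult; [| apply Clim_inv]; assumption. Qed.

Lemma Clim_Cexp (f : T -> C) (a : C) : Clim F f a -> Clim F (fun t => Cexp (f t)) (Cexp a).
Proof.
intros [H1 H2]; split; simpl; apply filterlim_Rmult.
1,3: apply (filterlim_Rcomp exp); [apply continuous_exp | assumption].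
- apply (filterlim_Rcomp cos); [apply continuous_cos | assumption].
- apply (filterlim_Rcomp sin); [apply continuous_sin | assumption].
Qed.

Lemma Clim_Cmod (f : T -> C) (a : C) :
  Clim F f a -> filterlim (fun t => Cmod (f t)) F (locally (Cmod a)).
Proof.
intros [H1 H2]; unfold Cmod.
apply (filterlim_Rcomp sqrt); [apply continuous_sqrt |].
simpl; apply filterlim_Rplus; repeat apply filterlim_Rmult;
    try apply filterlim_const; assumption.
Qed.

End Limits.

Lemma Cmod_le_lim {T : Type} (F : (T -> Prop) -> Prop) {FF : ProperFilter F}
  (f : T -> C) (e : T -> R) (a : C) (K : R) :
  Clim F f a -> filterlim e F (locally K) -> F (fun t => Cmod (f t) <= e t) -> Cmod a <= K.
Proof.
intros H HK He.
exact (filterlim_le (fun t => Cmod (f t)) e (Cmod a) K He (Clim_Cmod _ _ H) HK).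
Qed.

Lemma Clim_Cmod_lt {T : Type} (F : (T -> Prop) -> Prop) {FF : Filter F}
  (f : T -> C) (a : C) (K : R) :
  Clim F f a -> Cmod a < K -> F (fun t => Cmod (f t) < K).
Proof. intros H HK; exact (Clim_Cmod _ _ H _ (open_lt K (Cmod a) HK)). Qed.

Lemma re_im_le_Cmod (z : C) : Rabs (Re z) <= Cmod z /\ Rabs (Im z) <= Cmod z.
Proof.
split; [apply re_le_Cmod |].
apply Rle_trans with (2 := Rmax_Cmod z), Rmax_r.
Qed.

Lemma Cmod_le_re_im (z : C) : Cmod z <= Rabs (Re z) + Rabs (Im z).
Proof.
destruct z as [x y]; unfold Cmod; simpl.
apply Rsqr_incr_0_var; [| generalize (Rabs_pos x) (Rabs_pos y); lra].
rewrite Rsqr_sqrt by nra; unfold Rsqr.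
generalize (Rabs_pos x) (Rabs_pos y) (Rsqr_abs x) (Rsqr_abs y); unfold Rsqr; nra.
Qed.

Lemma Clim_of_Cmod {T} (F : (T -> Prop) -> Prop) {FF : Filter F} (f : T -> C) (a : C)
  (e : T -> R) :
  F (fun t => Cmod (f t - a) <= e t) -> filterlim e F (locally 0) -> Clim F f a.
Proof.
intros H He.
assert (L : forall p : C -> R, (forall z, Rabs (p z) <= Cmod z) ->
  (forall z, p (z - a)%C = p z - p a) ->
  filterlim (fun t => p (f t)) F (locally (p a))).
{ intros p Hp Hm; apply filterlim_locally; intros eps.
  generalize (proj1 (filterlim_locally e 0) He eps) H.
  intros H1 H2; generalize (filter_and _ _ H1 H2); apply filter_imp.
  intros t [B1 B2]; change (Rabs (p (f t) - p a) < eps).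
  change (Rabs (e t - 0) < eps) in B1.
  rewrite <- Hm; apply Rle_lt_trans with (1 := Hp _), Rle_lt_trans with (1 := B2).
  rewrite Rminus_0_r in B1; apply Rle_lt_trans with (2 := B1), Rle_abs. }
split; apply L; try (intros z; apply re_im_le_Cmod); intros z; reflexivity.
Qed.

(** Records an off-by-one: [sum_n] includes the index [n], [Csum] stops before it. *)
Lemma Csum_Rparts (a : nat -> C) (n : nat) :
  Csum a (S n) = (sum_n (fun k => Re (a k)) n, sum_n (fun k => Im (a k)) n).
Proof.
induction n as [|n IH].
- rewrite !sum_O; simpl; destruct (a O); unfold Cplus; simpl; f_equal; ring.
- change (Csum a (S (S n))) with (Csum a (S n) + a (S n))%C; rewrite IH, !sum_Sn; reflexivity.
Qed.

(** [Series] is total, so [CSeries] has a meaningful value only once convergence is known; every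
    evaluation of [multicos] passes through here. *)
Lemma CSeries_unique (a : nat -> C) (l : C) :
  Clim eventually (Csum a) l -> CSeries a = l.
Proof.
intros [H1 H2]; unfold CSeries; destruct l as [l1 l2]; f_equal; apply is_series_unique.
- apply (filterlim_ext (fun n => Re (Csum a (S n))));
    [intros n; rewrite Csum_Rparts; reflexivity |].
  apply (filterlim_comp _ _ _ S (fun n => Re (Csum a n)) _ eventually); [| exact H1].
  apply eventually_subseq; intros; lia.
- apply (filterlim_ext (fun n => Im (Csum a (S n))));
    [intros n; rewrite Csum_Rparts; reflexivity |].
  apply (filterlim_comp _ _ _ S (fun n => Im (Csum a n)) _ eventually); [| exact H2].
  apply eventually_subseq; intros; lia.
Qed.

Lemma Clim_CSeries (a : nat -> C) (D : nat -> R) :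
  (forall n, Cmod (a n) <= D n) -> ex_series D -> Clim eventually (Csum a) (CSeries a).
Proof.
intros Ha HD.
assert (E : ex_series (fun n => Re (a n)) /\ ex_series (fun n => Im (a n))).
{ split; apply (@ex_series_le R_AbsRing R_CompleteNormedModule) with (2 := HD);
    intros n; apply Rle_trans with (2 := Ha n); apply re_im_le_Cmod. }
destruct E as [E1 E2]; apply Series_correct in E1; apply Series_correct in E2.
split.
- apply (filterlim_ext_loc (fun n => sum_n (fun k => Re (a k)) (pred n))).
  { exists 1%nat; intros [|n] Hn; [lia |]; rewrite Csum_Rparts; reflexivity. }
  apply (filterlim_comp _ _ _ pred _ _ eventually _) with (2 := E1).
  intros P [N HN]; exists (S N); intros n Hn; apply HN; lia.
- apply (filterlim_ext_loc (fun n => sum_n (fun k => Im (a k)) (pred n))).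
  { exists 1%nat; intros [|n] Hn; [lia |]; rewrite Csum_Rparts; reflexivity. }
  apply (filterlim_comp _ _ _ pred _ _ eventually _) with (2 := E2).
  intros P [N HN]; exists (S N); intros n Hn; apply HN; lia.
Qed.

(** Tannery's theorem along an arbitrary filter. The tails after [N] are at most [eps / 4] for all
    admissible [t] and for the limit series, and the finite head converges termwise: three errors of
    a quarter each. *)
Lemma Series_dominated_lim {T} (F : (T -> Prop) -> Prop) {FF : ProperFilter F}
  (u : T -> nat -> R) (l : nat -> R) (D : nat -> R) :
  (F (fun t => forall n, Rabs (u t n) <= D n)) -> ex_series D ->
  (forall n, filterlim (fun t => u t n) F (locally (l n))) ->
  filterlim (fun t => Series (u t)) F (locally (Series l)).
Proof.
intros Hu HD Hl.
assert (Hlb : forall n, Rabs (l n) <= D n).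
{ intros n.
  apply (filterlim_le (F:=F) (fun t => Rabs (u t n)) (fun _ => D n) (Rabs (l n)) (D n)).
  - revert Hu; apply filter_imp; auto.
  - apply (filterlim_Rcomp Rabs); [apply continuous_Rabs | apply Hl].
  - apply filterlim_const. }
assert (El : ex_series l).
{ apply (@ex_series_le R_AbsRing R_CompleteNormedModule) with (2 := HD); exact Hlb. }
apply filterlim_locally; intros eps.
assert (HDs := Series_correct _ HD).
assert (He : 0 < eps / 4) by (destruct eps; simpl; lra).
destruct (proj1 (filterlim_locally _ _) HDs (mkposreal _ He)) as [N HN].
specialize (HN N (le_n N)); change (Rabs (sum_n D N - Series D) < eps / 4) in HN.
assert (Hfin : filterlim (fun t => sum_n (u t) N) F (locally (sum_n l N))).
{ clear - Hl FF; induction N as [|N IH].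
  - apply (filterlim_ext (fun t => u t O)); [intros; rewrite sum_O; reflexivity |].
    rewrite sum_O; apply Hl.
  - apply (filterlim_ext (fun t => sum_n (u t) N + u t (S N)));
      [intros; rewrite sum_Sn; reflexivity |].
    rewrite sum_Sn; apply filterlim_Rplus; [exact IH | apply Hl]. }
assert (Htail : forall v : nat -> R, (forall n, Rabs (v n) <= D n) ->
   Rabs (Series v - sum_n v N) <= eps / 4).
{ intros v Hv.
  assert (Ev : ex_series v).
  { apply (@ex_series_le R_AbsRing R_CompleteNormedModule) with (2 := HD); exact Hv. }
  rewrite (Series_incr_n v (S N)) by (lia || exact Ev).
  rewrite (Series_incr_n D (S N)) in HN by (lia || exact HD).
  simpl pred in *; rewrite <- sum_n_Reals in *.
  replace (sum_n v N + Series (fun k => v (S N + k)%nat) - sum_n v N)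
    with (Series (fun k => v (S N + k)%nat)) by ring.
  assert (HD' : ex_series (fun k => D (S N + k)%nat)) by (apply ex_series_incr_n; exact HD).
  apply Rle_trans with (Series (fun k => D (S N + k)%nat)).
  - apply Rle_trans with (Series (fun k => Rabs (v (S N + k)%nat))).
    + apply Series_Rabs.
      apply (@ex_series_le R_AbsRing R_CompleteNormedModule) with (2 := HD').
      intros n; change (Rabs (Rabs (v (S N + n)%nat)) <= D (S N + n)%nat).
      rewrite Rabs_Rabsolu; apply Hv.
    + apply Series_le; [| exact HD']; intros n; split; [apply Rabs_pos | apply Hv].
  - apply Rabs_def2 in HN; lra. }
generalize (proj1 (filterlim_locally _ _) Hfin (mkposreal _ He)) Hu.
intros H1 H2; generalize (filter_and _ _ H1 H2); apply filter_imp.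
intros t [B1 B2]; change (Rabs (Series (u t) - Series l) < eps).
change (Rabs (sum_n (u t) N - sum_n l N) < eps / 4) in B1.
generalize (Htail _ B2) (Htail _ Hlb); intros B3 B4.
apply Rabs_def2 in B1; apply Rabs_le_between in B3; apply Rabs_le_between in B4.
apply Rabs_def1; lra.
Qed.

Lemma Clim_CSeries_dominated {T} (F : (T -> Prop) -> Prop) {FF : ProperFilter F}
  (u : T -> nat -> C) (l : nat -> C) (D : nat -> R) :
  (F (fun t => forall n, Cmod (u t n) <= D n)) -> ex_series D ->
  (forall n, Clim F (fun t => u t n) (l n)) ->
  Clim F (fun t => CSeries (u t)) (CSeries l).
Proof.
intros Hu HD Hl; split; unfold CSeries; simpl; apply (Series_dominated_lim F) with (D := D);
  try exact HD; try (intros n; apply Hl); revert Hu; apply filter_imp;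
  intros t Ht n; apply Rle_trans with (2 := Ht n); apply re_im_le_Cmod.
Qed.

Lemma Cder_eq (f : R -> C) (t : R) (l l' : C) : l = l' -> Cder f t l -> Cder f t l'.
Proof. intros ->; trivial. Qed.

Lemma Cder_ext (f g : R -> C) (t : R) (l : C) : (forall s, f s = g s) -> Cder f t l -> Cder g t l.
Proof.
intros E [H1 H2]; split; [apply is_derive_ext with (2 := H1) | apply is_derive_ext with (2 := H2)];
  intros s; rewrite E; reflexivity.
Qed.

Lemma Cder_const (c : C) (t : R) : Cder (fun _ => c) t 0.
Proof. split; apply (@is_derive_const R_AbsRing R_NormedModule). Qed.

Lemma Cder_plus (f g : R -> C) (t : R) (a b : C) :
  Cder f t a -> Cder g t b -> Cder (fun s => f s + g s)%C t (a + b)%C.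
Proof.
intros [H1 H2] [H3 H4]; split; simpl;
  apply (@is_derive_plus R_AbsRing R_NormedModule); assumption.
Qed.

Lemma is_derive_Rmult (f g : R -> R) (t a b : R) :
  is_derive f t a -> is_derive g t b -> is_derive (fun s => f s * g s) t (a * g t + f t * b).
Proof. intros; apply (@is_derive_mult R_AbsRing f g); try assumption; exact Rmult_comm. Qed.

Lemma Cder_mult (f g : R -> C) (t : R) (a b : C) :
  Cder f t a -> Cder g t b -> Cder (fun s => f s * g s)%C t (a * g t + f t * b)%C.
Proof.
intros [H1 H2] [H3 H4]; split; simpl.
- evar_last.
  { apply (@is_derive_minus R_AbsRing R_NormedModule); apply is_derive_Rmult; eassumption. }
  unfold minus, plus, opp, Re, Im; simpl; ring.
- evar_last.
  { apply (@is_derive_plus R_AbsRing R_NormedModule); apply is_derive_Rmult; eassumption. }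
  unfold plus, Re, Im; simpl; ring.
Qed.

Lemma Cder_scal (c : C) (f : R -> C) (t : R) (a : C) :
  Cder f t a -> Cder (fun s => c * f s)%C t (c * a)%C.
Proof.
intros H; apply Cder_eq with (2 := Cder_mult _ _ _ _ _ (Cder_const c t) H); ring.
Qed.

Lemma Cder_opp (f : R -> C) (t : R) (a : C) : Cder f t a -> Cder (fun s => - f s)%C t (- a)%C.
Proof.
intros [H1 H2]; split; simpl; apply (@is_derive_opp R_AbsRing R_NormedModule); assumption.
Qed.

Lemma Cder_minus (f g : R -> C) (t : R) (a b : C) :
  Cder f t a -> Cder g t b -> Cder (fun s => f s - g s)%C t (a - b)%C.
Proof. intros; apply Cder_plus; [| apply Cder_opp]; assumption. Qed.

Lemma Cder_line (x : C) (t : R) : Cder (fun s => RtoC s * x)%C t x.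
Proof. split; simpl; auto_derive; trivial; unfold Re, Im; ring. Qed.

Lemma Cder_pow (f : R -> C) (t : R) (a : C) (n : nat) :
  Cder f t a -> Cder (fun s => Cpow (f s) (S n)) t (INR (S n) * Cpow (f t) n * a)%C.
Proof.
intros H; induction n as [|n IH].
- apply Cder_ext with (f := f); [intros s; simpl; ring |].
  apply Cder_eq with (2 := H); simpl; ring.
- change (fun s => Cpow (f s) (S (S n))) with (fun s => f s * Cpow (f s) (S n))%C.
  apply Cder_eq with (2 := Cder_mult _ _ _ _ _ H IH).
  rewrite (S_INR (S n)), RtoC_plus; simpl; ring.
Qed.

Lemma Cder_sum (f : R -> nat -> C) (t : R) (a : nat -> C) (n : nat) :
  (forall k, (k < n)%nat -> Cder (fun s => f s k) t (a k)) ->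
  Cder (fun s => Csum (f s) n) t (Csum a n).
Proof.
induction n as [|n IH]; intros H; simpl.
- apply Cder_const.
- apply Cder_plus; [apply IH; intros; apply H; lia | apply H; lia].
Qed.

Lemma Cder_Cexp (f : R -> C) (t : R) (a : C) :
  Cder f t a -> Cder (fun s => Cexp (f s)) t (Cexp (f t) * a)%C.
Proof.
intros [H1 H2].
assert (E : is_derive (fun s => exp (Re (f s))) t (Re a * exp (Re (f t)))).
{ apply (is_derive_comp exp (fun s => Re (f s))); [apply is_derive_exp | exact H1]. }
split; simpl.
- evar_last; [apply is_derive_Rmult; [exact E |];
   apply (is_derive_comp cos (fun s => Im (f s))); [apply is_derive_cos | exact H2] |].
  unfold scal; simpl; unfold mult; simpl; unfold Re, Im; ring.
- evar_last; [apply is_derive_Rmult; [exact E |];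
   apply (is_derive_comp sin (fun s => Im (f s))); [apply is_derive_sin | exact H2] |].
  unfold scal; simpl; unfold mult; simpl; unfold Re, Im; ring.
Qed.

(** * The principal logarithm along a path *)

Definition slit (z : C) : Prop := 0 < Re z \/ Im z <> 0.

Lemma slit_neq0 (z : C) : slit z -> z <> 0.
Proof. intros [H|H] E; subst z; simpl in H; lra. Qed.

(** The definition of [Carg] changes its formula at [Re z = 0]. The inverted quotient [Re z / Im z]
    gives a single smooth formula on the whole open half-plane, so nothing has to be glued across
    the imaginary axis. *)
Lemma Carg_im_pos (z : C) : 0 < Im z -> Carg z = PI / 2 - atan (Re z / Im z).
Proof.
unfold Carg; destruct z as [x y]; simpl; intros Hy.
destruct (Rlt_dec 0 x) as [Hx|Hx].
- rewrite <- atan_inv by (apply Rdiv_lt_0_compat; assumption); f_equal; field; lra.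
- destruct (Rlt_dec x 0) as [Hx'|Hx'].
  + destruct (Rle_dec 0 y); [| lra].
    replace (y / x) with (- / (- x / y)) by (field; lra).
    rewrite atan_opp, atan_inv by (apply Rdiv_lt_0_compat; lra).
    replace (- x / y) with (- (x / y)) by (field; lra); rewrite atan_opp; lra.
  + replace x with 0 by lra; destruct (Rlt_dec 0 y); [| lra].
    unfold Rdiv; rewrite Rmult_0_l, atan_0; lra.
Qed.

Lemma Carg_im_neg (z : C) : Im z < 0 -> Carg z = - (PI / 2) - atan (Re z / Im z).
Proof.
unfold Carg; destruct z as [x y]; simpl; intros Hy.
destruct (Rlt_dec 0 x) as [Hx|Hx].
- replace (y / x) with (- / (x / - y)) by (field; lra).
  rewrite atan_opp, atan_inv by (apply Rdiv_lt_0_compat; lra).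
  replace (x / - y) with (- (x / y)) by (field; lra); rewrite atan_opp; lra.
- destruct (Rlt_dec x 0) as [Hx'|Hx'].
  + destruct (Rle_dec 0 y); [lra |].
    replace (y / x) with (/ (x / y)) by (field; lra).
    rewrite atan_inv; [lra |].
    replace (x / y) with (- x / - y) by (field; lra); apply Rdiv_lt_0_compat; lra.
  + replace x with 0 by lra; destruct (Rlt_dec 0 y); [lra |].
    destruct (Rlt_dec y 0); [| lra].
    unfold Rdiv; rewrite Rmult_0_l, atan_0; lra.
Qed.

Lemma Carg_re_pos (z : C) : 0 < Re z -> Carg z = atan (Im z / Re z).
Proof. intros H; unfold Carg; destruct (Rlt_dec 0 (Re z)); [reflexivity | lra]. Qed.

Lemma is_derive_quot_atan (u v : R -> R) (t du dv : R) :
  v t <> 0 -> is_derive u t du -> is_derive v t dv ->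
  is_derive (fun s => atan (u s / v s)) t ((du * v t - u t * dv) / (u t ^ 2 + v t ^ 2)).
Proof.
intros Hv Hu Hdv.
evar_last.
{ apply (is_derive_comp atan (fun s => u s / v s)); [apply is_derive_atan |].
  apply is_derive_div; eassumption. }
unfold scal; simpl; unfold mult; simpl; unfold Rsqr; field; split; nra.
Qed.

Lemma locally_derive_gt (f : R -> R) (t l c : R) :
  is_derive f t l -> c < f t -> locally t (fun s => c < f s).
Proof.
intros H Hc; assert (K : continuous f t).
{ apply (@ex_derive_continuous R_AbsRing R_NormedModule); exists l; exact H. }
apply (K (fun y => c < y)), open_gt; exact Hc.
Qed.

Lemma locally_derive_lt (f : R -> R) (t l c : R) :
  is_derive f t l -> f t < c -> locally t (fun s => f s < c).
Proof.
intros H Hc; assert (K : continuous f t).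
{ apply (@ex_derive_continuous R_AbsRing R_NormedModule); exists l; exact H. }
apply (K (fun y => y < c)), open_lt; exact Hc.
Qed.

(** The right, upper and lower half-planes cover the slit plane, and on each of them the argument is
    an arctangent up to sign and constant. *)
Lemma Cder_CLog (f : R -> C) (t : R) (a : C) :
  slit (f t) -> Cder f t a -> Cder (fun s => CLog (f s)) t (a / f t)%C.
Proof.
intros Hs [H1 H2].
assert (Hn : 0 < Re (f t) ^ 2 + Im (f t) ^ 2) by (destruct Hs; nra).
split; simpl.
- evar_last.
  { apply (is_derive_comp ln (fun s => Cmod (f s))).
    - apply is_derive_ln, Cmod_gt_0, slit_neq0; exact Hs.
    - apply (is_derive_sqrt (fun s => fst (f s) ^ 2 + snd (f s) ^ 2)); [| exact Hn].
      apply (@is_derive_plus R_AbsRing R_NormedModule); apply is_derive_pow; eassumption. }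
  unfold scal; simpl; unfold mult, plus; simpl; unfold Cmod.
  assert (Q := sqrt_lt_R0 _ Hn); unfold Re, Im in *; simpl in *.
  set (q := sqrt _) in *.
  assert (Q2 : q * q = fst (f t) * (fst (f t) * 1) + snd (f t) * (snd (f t) * 1))
    by (apply sqrt_sqrt; lra).
  rewrite <- Q2; rewrite <- Q2 in Hn; field; lra.
- assert (E : is_derive (fun s => Carg (f s)) t
     ((Im a * Re (f t) - Im (f t) * Re a) / (Im (f t) ^ 2 + Re (f t) ^ 2))).
  { destruct (Rlt_dec 0 (Re (f t))) as [Hr|Hr].
    - apply is_derive_ext_loc with (fun s => atan (Im (f s) / Re (f s))).
      + generalize (locally_derive_gt _ _ _ 0 H1 Hr); apply filter_imp.
        intros s Hp; symmetry; apply Carg_re_pos; exact Hp.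
      + apply (is_derive_quot_atan (fun s => Im (f s)) (fun s => Re (f s)));
          [lra | exact H2 | exact H1].
    - destruct Hs as [Hs|Hs]; [contradiction |].
      assert (G : forall c, is_derive (fun s => c - atan (Re (f s) / Im (f s))) t
        ((Im a * Re (f t) - Im (f t) * Re a) / (Im (f t) ^ 2 + Re (f t) ^ 2))).
      { intros c; evar_last.
        { apply (@is_derive_minus R_AbsRing R_NormedModule);
            [apply (@is_derive_const R_AbsRing R_NormedModule) |].
          apply (is_derive_quot_atan (fun s => Re (f s)) (fun s => Im (f s)));
            [exact Hs | exact H1 | exact H2]. }
        unfold minus, plus, opp, zero; simpl; unfold Re, Im in *; field; nra. }
      destruct (Rlt_dec 0 (Im (f t))) as [Hi|Hi].
      + apply is_derive_ext_loc with (2 := G (PI / 2)).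
        generalize (locally_derive_gt _ _ _ 0 H2 Hi); apply filter_imp.
        intros s Hp; symmetry; apply Carg_im_pos; exact Hp.
      + assert (Hi' : Im (f t) < 0) by lra.
        apply is_derive_ext_loc with (2 := G (- (PI / 2))).
        generalize (locally_derive_lt _ _ _ 0 H2 Hi'); apply filter_imp.
        intros s Hp; symmetry; apply Carg_im_neg; exact Hp. }
  evar_last; [exact E |].
  unfold Re, Im in *; field; nra.
Qed.

(** The right half-plane is enough: limits of logarithms are taken only at [1 - y] and [1 + y] with
    [y] real in [(-1, 1)], and at values of [1 + exp (- pi i x)] with positive real part. *)
Lemma Clim_CLog {T} (F : (T -> Prop) -> Prop) {FF : Filter F} (f : T -> C) (a : C) :
  0 < Re a -> Clim F f a -> Clim F (fun t => CLog (f t)) (CLog a).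
Proof.
intros Ha H; assert (HC := H); destruct H as [H1 H2]; split; simpl.
- apply (filterlim_Rcomp ln).
  + apply continuous_ln, Cmod_gt_0; intros E; subst a; simpl in Ha; lra.
  + apply Clim_Cmod; exact HC.
- rewrite Carg_re_pos by exact Ha.
  apply (filterlim_ext_loc (fun t => atan (Im (f t) / Re (f t)))).
  + generalize (H1 _ (open_gt 0 (Re a) Ha)); unfold filtermap; apply filter_imp.
    intros t Ht; symmetry; apply Carg_re_pos; exact Ht.
  + apply (filterlim_Rcomp atan); [apply continuous_atan |].
    apply filterlim_Rmult; [exact H2 |].
    apply (filterlim_Rcomp Rinv); [apply continuous_Rinv; lra | exact H1].
Qed.

(** The mean value theorem fails for complex values; it is applied to real and imaginary parts
    separately, which costs the factor 2. *)
Lemma Cmod_mean_value (f f' : R -> C) (a b K : R) :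
  a <= b -> (forall t, a <= t <= b -> Cder f t (f' t)) ->
  (forall t, a <= t <= b -> Cmod (f' t) <= K) -> Cmod (f b - f a) <= 2 * K * (b - a).
Proof.
intros Hab Hd HK.
assert (L : forall p : C -> R, (forall z, Rabs (p z) <= Cmod z) ->
  (forall t, a <= t <= b -> is_derive (fun s => p (f s)) t (p (f' t))) ->
  Rabs (p (f b) - p (f a)) <= K * (b - a)).
{ intros p Hp Hdp.
  destruct (MVT_gen (fun s => p (f s)) a b (fun t => p (f' t))) as [c [Hc E]].
  - rewrite Rmin_left, Rmax_right by exact Hab; intros; apply Hdp; lra.
  - rewrite Rmin_left, Rmax_right by exact Hab; intros x Hx.
    apply derivable_continuous_pt; exists (p (f' x)); apply is_derive_Reals, Hdp, Hx.
  - rewrite Rmin_left, Rmax_right in Hc by exact Hab.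
    rewrite E, Rabs_mult, (Rabs_right (b - a)) by lra.
    apply Rmult_le_compat_r; [lra |]; apply Rle_trans with (1 := Hp _), HK, Hc. }
apply Rle_trans with (1 := Cmod_le_re_im _).
generalize (L Re (fun z => proj1 (re_im_le_Cmod z)) (fun t Ht => proj1 (Hd t Ht))).
generalize (L Im (fun z => proj2 (re_im_le_Cmod z)) (fun t Ht => proj2 (Hd t Ht))).
destruct (f a), (f b); simpl; unfold Rminus; intros; lra.
Qed.

(** * Partial fractions of the tangent *)

Lemma Cexp_plus (a b : C) : Cexp (a + b) = (Cexp a * Cexp b)%C.
Proof.
unfold Cexp, Cmult, Re, Im; simpl.
rewrite exp_plus, cos_plus, sin_plus; f_equal; ring.
Qed.

Lemma Cexp_0 : Cexp 0 = 1.
Proof. unfold Cexp; simpl; rewrite exp_0, cos_0, sin_0, !Rmult_1_l; reflexivity. Qed.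

Lemma Cmod_Cexp (z : C) : Cmod (Cexp z) = exp (Re z).
Proof.
unfold Cmod, Cexp; simpl.
replace (_ + _) with (exp (Re z) ^ 2 * (Rsqr (cos (Im z)) + Rsqr (sin (Im z))))
  by (unfold Rsqr; ring).
rewrite Rplus_comm, sin2_cos2, Rmult_1_r; apply sqrt_pow2, Rlt_le, exp_pos.
Qed.

Lemma Cexp_neq0 (z : C) : Cexp z <> 0.
Proof. apply Cmod_gt_0; rewrite Cmod_Cexp; apply exp_pos. Qed.

Lemma Cexp_opp (z : C) : Cexp (- z) = (/ Cexp z)%C.
Proof.
assert (E : (Cexp (- z) * Cexp z)%C = 1).
{ rewrite <- Cexp_plus; replace (- z + z)%C with (RtoC 0) by ring; apply Cexp_0. }
generalize (Cexp_neq0 z); intros N.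
replace (Cexp (- z)) with (Cexp (- z) * Cexp z * / Cexp z)%C by (field; exact N).
rewrite E; ring.
Qed.

Lemma Cpow_Cexp (z : C) (n : nat) : Cpow (Cexp z) n = Cexp (INR n * z).
Proof.
induction n as [|n IH].
- simpl; rewrite Cmult_0_l, Cexp_0; reflexivity.
- simpl Cpow; rewrite IH, <- Cexp_plus, S_INR, RtoC_plus; f_equal; ring.
Qed.

Lemma Cexp_cos (t : R) : (Cexp (t * Ci) + Cexp (- (t * Ci)))%C = RtoC (2 * cos t).
Proof.
unfold Cexp, RtoC, Cplus; simpl.
replace (t * 0 - 0 * 1) with 0 by ring; replace (t * 1 + 0 * 0) with t by ring.
rewrite Ropp_0, exp_0, cos_neg, sin_neg; f_equal; ring.
Qed.

Lemma Csum_ext (f g : nat -> C) (n : nat) :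
  (forall k, (k < n)%nat -> f k = g k) -> Csum f n = Csum g n.
Proof.
induction n as [|n IH]; intros H; simpl; [reflexivity |].
rewrite IH, H; auto with arith.
Qed.

Lemma Csum_add (f : nat -> C) (m n : nat) :
  Csum f (m + n) = (Csum f m + Csum (fun k => f (m + k)%nat) n)%C.
Proof.
induction n as [|n IH]; simpl.
- rewrite Nat.add_0_r; ring.
- rewrite Nat.add_succ_r; simpl; rewrite IH; ring.
Qed.

Lemma Csum_plus (f g : nat -> C) (n : nat) :
  Csum (fun k => f k + g k)%C n = (Csum f n + Csum g n)%C.
Proof. induction n as [|n IH]; simpl; [ring | rewrite IH; ring]. Qed.

Lemma Csum_scal (c : C) (f : nat -> C) (n : nat) :
  Csum (fun k => c * f k)%C n = (c * Csum f n)%C.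
Proof. induction n as [|n IH]; simpl; [ring | rewrite IH; ring]. Qed.

Lemma Csum_S_l (f : nat -> C) (n : nat) :
  Csum f (S n) = (f O + Csum (fun k => f (S k)) n)%C.
Proof. change (S n) with (1 + n)%nat; rewrite Csum_add; simpl; ring. Qed.

Lemma Csum_rev (f : nat -> C) (n : nat) :
  Csum (fun k => f (n - 1 - k)%nat) n = Csum f n.
Proof.
induction n as [|n IH]; [reflexivity |].
rewrite Csum_S_l; simpl Csum at 2; rewrite <- IH.
rewrite Cplus_comm; f_equal.
- apply Csum_ext; intros k Hk; f_equal; lia.
- f_equal; lia.
Qed.

(** The telescoping majorant is the source of the rate [1 / N] in all later estimates. *)
Lemma Csum_tail (u : nat -> C) (c : R) (N K : nat) :
  0 <= c -> (1 <= N)%nat -> (N <= K)%nat ->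
  (forall j, (N <= j < K)%nat -> Cmod (u j) <= c * (/ INR j - / INR (S j))) ->
  Cmod (Csum u K - Csum u N) <= c / INR N.
Proof.
intros Hc HN HK H.
assert (P : 0 < INR N) by (apply lt_0_INR; lia).
assert (G : Cmod (Csum u K - Csum u N) <= c * (/ INR N - / INR K)).
{ revert H; induction HK as [|K HK IH]; intros H.
  - replace (Csum u N - Csum u N)%C with (RtoC 0) by ring; rewrite Cmod_0.
    right; ring.
  - simpl Csum.
    replace (Csum u K + u K - Csum u N)%C with (Csum u K - Csum u N + u K)%C by ring.
    apply Rle_trans with (1 := Cmod_triangle _ _).
    assert (H1 : Cmod (Csum u K - Csum u N) <= c * (/ INR N - / INR K))
      by (apply IH; intros j Hj; apply H; lia).
    assert (H2 := H K ltac:(lia)); lra. }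
assert (0 < / INR K) by (apply Rinv_0_lt_compat, lt_0_INR; lia).
unfold Rdiv; nra.
Qed.

(** For [c = cos t] this is the sum of [v^|n| exp (i n t)] over all integers [n], with [v] complex
    in the unit disc. *)
Definition poisson (v : C) (c : R) : C := ((1 - v * v) / (1 - 2 * v * c + v * v))%C.

(** The denominator factors as [(1 - v exp (i t)) (1 - v exp (- i t))], which vanishes only for [v]
    on the unit circle. *)
Lemma poisson_den_neq0 (v : C) (t : R) :
  Cmod v < 1 -> (1 - 2 * v * cos t + v * v)%C <> 0.
Proof.
intros Hv.
replace (1 - 2 * v * cos t + v * v)%C
  with ((1 - v * Cexp (t * Ci)) * (1 - v * Cexp (- (t * Ci))))%C.
- assert (K : forall s : R, (1 - v * Cexp (s * Ci))%C <> 0).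
  { intros s E; assert (E1 : (v * Cexp (s * Ci))%C = 1).
    { replace (v * Cexp (s * Ci))%C with (1 - (1 - v * Cexp (s * Ci)))%C by ring.
      rewrite E; ring. }
    apply (f_equal Cmod) in E1; rewrite Cmod_mult, Cmod_Cexp, Cmod_1 in E1.
    unfold Re in E1; simpl in E1; replace (s * 0 - 0 * 1) with 0 in E1 by ring.
    rewrite exp_0 in E1; lra. }
  apply Cmult_neq_0; [apply K |].
  replace (- (t * Ci))%C with (RtoC (- t) * Ci)%C by (rewrite RtoC_opp; ring); apply K.
- assert (E := Cexp_cos t); rewrite RtoC_mult in E.
  replace (2 * v * cos t)%C with (v * (2 * cos t))%C by ring; rewrite <- E.
  rewrite Cexp_opp; field; apply Cexp_neq0.
Qed.

(** Averaging over [t] and [t + PI] cancels the odd Fourier modes; the even ones form the kernel of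
    [v * v] at [2 * t]. *)
Lemma poisson_double (v : C) (t : R) : Cmod v < 1 ->
  poisson (v * v) (cos (2 * t)) = (/ 2 * (poisson v (cos t) + poisson v (cos (t + PI))))%C.
Proof.
intros Hv; unfold poisson.
assert (H1 := poisson_den_neq0 v t Hv); assert (H2 := poisson_den_neq0 v (t + PI) Hv).
rewrite neg_cos in *; rewrite cos_2a_cos.
rewrite RtoC_minus, !RtoC_mult, RtoC_opp in *.
assert (H3 : (1 - v * v * (v * v))%C = ((1 - v * v) * (1 + v * v))%C) by ring.
rewrite H3.
replace (1 - 2 * (v * v) * (2 * cos t * cos t - 1) + v * v * (v * v))%C with
  ((1 - 2 * v * cos t + v * v) * (1 - 2 * v * - cos t + v * v))%C by ring.
field; repeat split; assumption.
Qed.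

Lemma RtoC_neq0 (x : R) : x <> 0 -> RtoC x <> 0.
Proof. intros H E; apply H; exact (f_equal fst E). Qed.

Lemma Cmod_2_PI_Ci : Cmod (2 * PI * Ci) = 2 * PI.
Proof.
rewrite !Cmod_mult, !Cmod_R, !Rabs_right by (generalize PI_RGT_0; lra).
replace (Cmod Ci) with 1; [ring |].
unfold Cmod; simpl; rewrite !Rmult_0_l, !Rmult_1_l, Rplus_0_l, sqrt_1; reflexivity.
Qed.

Lemma two_PI_Ci_neq0 : (2 * PI * Ci)%C <> 0.
Proof. apply Cmod_gt_0; rewrite Cmod_2_PI_Ci; generalize PI_RGT_0; lra. Qed.

(** Iterated duplication keeps the Fourier modes divisible by [2 ^ m]. In the induction, raising the
    index by [2 ^ m] turns the angle by [PI], so the two halves of the longer sum supply the pairs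
    of [poisson_double]. *)
Lemma poisson_section (m : nat) (v : C) (t : R) : Cmod v < 1 ->
  poisson (Cpow v (2 ^ m)) (cos (2 ^ m * t)) =
  (/ (2 ^ m)%R * Csum (fun j => poisson v (cos (t + INR j * (2 * PI) / 2 ^ m))) (2 ^ m))%C.
Proof.
revert v t; induction m as [|m IH]; intros v t Hv.
- simpl; rewrite Rmult_1_l; replace (v * 1)%C with v by ring.
  replace (t + 0 * (2 * PI) / 1) with t by field; field; apply RtoC_neq0; lra.
- assert (Hv2 : Cmod (v * v) < 1) by (rewrite Cmod_mult; generalize (Cmod_ge_0 v); nra).
  replace (2 ^ S m)%nat with (2 ^ m + 2 ^ m)%nat by (simpl; lia).
  rewrite Cpow_add_r, <- Cpow_mult_l.
  replace (2 ^ S m * t) with (2 ^ m * (2 * t)) by (simpl; ring).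
  rewrite IH by exact Hv2.
  rewrite Csum_add, <- Csum_plus.
  rewrite (Csum_ext _ (fun j => (/ 2 * (poisson v (cos (t + INR j * (2 * PI) / 2 ^ S m)) +
     poisson v (cos (t + INR (2 ^ m + j) * (2 * PI) / 2 ^ S m))))%C)).
  + rewrite Csum_scal.
    assert (P : 2 ^ m <> 0) by (apply pow_nonzero; lra).
    change (2 ^ S m)%R with (2 * 2 ^ m)%R; rewrite RtoC_mult.
    field; apply RtoC_neq0, P.
  + intros j Hj; assert (P : 2 ^ m <> 0) by (apply pow_nonzero; lra).
    replace (2 * t + INR j * (2 * PI) / 2 ^ m) with (2 * (t + INR j * (2 * PI) / 2 ^ S m))
      by (simpl; field; exact P).
    rewrite poisson_double by exact Hv; do 4 f_equal.
    rewrite plus_INR, pow_INR; change (INR 2) with 2; simpl; field; exact P.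
Qed.

(** The positive poles of [tan (pi z)]. *)
Definition half_odd (j : nat) : R := INR (2 * j + 1) / 2.

Lemma half_odd_eq (j : nat) : half_odd j = INR j + / 2.
Proof. unfold half_odd; rewrite plus_INR, mult_INR; simpl; field. Qed.

Lemma half_odd_pos (j : nat) : 0 < half_odd j.
Proof. rewrite half_odd_eq; generalize (pos_INR j); lra. Qed.

Lemma inv_half_odd_le (j : nat) : 0 < / half_odd j <= 2.
Proof.
assert (P := half_odd_eq j); generalize (pos_INR j); intros Hj.
split; [apply Rinv_0_lt_compat; lra |].
replace 2 with (/ / 2) by field; apply Rinv_le_contravar; lra.
Qed.

(** [chord M z = 2 i M sin (pi z / M)]. *)
Definition chord (M : R) (z : C) : C :=
  (M * (Cexp (/ M * (PI * Ci * z)) - Cexp (- (/ M * (PI * Ci * z)))))%C.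

(** Since [chord M z] tends to [2 pi i z] as [M] grows, this tends to [2 z / (a^2 - z^2)] with
    [a = half_odd j], a term of the partial fraction expansion. *)
Definition tan_term (M : R) (z : C) (j : nat) : C :=
  (- (2 * PI * Ci) * chord M (2 * z) /
     (chord M z * chord M z - chord M (half_odd j) * chord M (half_odd j)))%C.

Lemma chord_sqr (M : R) (z : C) : M <> 0 ->
  (chord M z * chord M z)%C =
  (M * M * (Cexp (/ M * (2 * PI * Ci * z)) + Cexp (- (/ M * (2 * PI * Ci * z))) - 2))%C.
Proof.
intros HM; unfold chord.
replace (/ M * (2 * PI * Ci * z))%C with (/ M * (PI * Ci * z) + / M * (PI * Ci * z))%C by ring.
rewrite !Cexp_opp, Cexp_plus; field; apply Cexp_neq0.
Qed.

(** Dividing numerator and denominator of the kernel by [v] gives [/ v - v], a chord at [2 z], over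
    [/ v + v - 2 cos], a difference of two squared chords. Unlike the kernel itself, this form has a
    visible limit for large [M]. *)
Lemma poisson_chord (M : R) (z : C) (j : nat) : 0 < M -> Im z < 0 ->
  let v := Cexp (- (/ M * (2 * PI * Ci * z))) in
  (- (PI * Ci) * (2 * / M * poisson v (cos (2 * PI * half_odd j / M))))%C = tan_term M z j.
Proof.
intros HM Hz v.
assert (HM' : RtoC M <> 0) by (apply RtoC_neq0; lra).
assert (Hv : Cmod v < 1).
{ unfold v; rewrite Cmod_Cexp, <- exp_0; apply exp_increasing.
  rewrite <- RtoC_inv by lra; destruct z as [x y]; simpl in *.
  generalize PI_RGT_0; intros HP; assert (0 < / M) by (apply Rinv_0_lt_compat, HM).
  assert (0 < / M * PI) by nra; nra. }
assert (Nv : v <> 0) by apply Cexp_neq0.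
assert (D := poisson_den_neq0 v (2 * PI * half_odd j / M) Hv).
unfold tan_term; rewrite !chord_sqr by lra.
replace (chord M (2 * z)) with (M * (/ v - v))%C.
2: { unfold chord, v; rewrite !Cexp_opp.
     replace (/ M * (2 * PI * Ci * z))%C with (/ M * (PI * Ci * (2 * z)))%C by ring.
     field; apply Cexp_neq0. }
replace (Cexp (/ M * (2 * PI * Ci * z))) with (/ v)%C.
2: { unfold v; rewrite Cexp_opp; field; apply Cexp_neq0. }
fold v.
assert (E := Cexp_cos (2 * PI * half_odd j / M)).
replace (RtoC (2 * PI * half_odd j / M) * Ci)%C with (/ M * (2 * PI * Ci * half_odd j))%C in E
  by (unfold Rdiv; rewrite !RtoC_mult, RtoC_inv by lra; ring).
rewrite E, RtoC_mult; unfold poisson.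
set (c := RtoC (cos _)) in *.
replace (M * M * (/ v + v - 2) - M * M * (2 * c - 2))%C
  with (M * M * (/ v * (1 - 2 * v * c + v * v)))%C by (field; exact Nv).
field; repeat split; assumption.
Qed.

(** The left-hand side is [pi tan (pi z)], because at the angle [PI] the kernel of [w] is
    [(1 - w) / (1 + w) = i tan (pi z)]. The section formula spreads it over the odd multiples of
    [PI / 2 ^ S m], which pair up under [t -> 2 PI - t]. *)
Lemma tan_section (m : nat) (z : C) : Im z < 0 ->
  let w := Cexp (- (2 * PI * Ci * z)) in
  (- (PI * Ci) * ((1 - w) / (1 + w)))%C = Csum (tan_term (2 ^ S m) z) (2 ^ m).
Proof.
intros Hz w.
assert (PM : 0 < 2 ^ S m) by (apply pow_lt; lra).
(* A root of [w] of order [2 ^ S m]. *)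
set (v := Cexp (- (/ (2 ^ S m)%R * (2 * PI * Ci * z)))).
assert (Hv : forall s : R, 0 < s -> Cmod (Cexp (- (s * (2 * PI * Ci * z)))) < 1).
{ intros s Hs; rewrite Cmod_Cexp, <- exp_0; apply exp_increasing.
  destruct z as [x y]; simpl in *; generalize PI_RGT_0; intros HP.
  assert (0 < s * PI) by nra; nra. }
assert (Vw : Cpow v (2 ^ S m) = w).
{ unfold v, w; rewrite Cpow_Cexp, pow_INR; f_equal; change (INR 2) with 2.
  field; apply RtoC_neq0; lra. }
assert (S0 := poisson_section (S m) v (PI / 2 ^ S m)).
replace (2 ^ S m * (PI / 2 ^ S m)) with PI in S0 by (field; lra).
rewrite Vw in S0.
replace (poisson w (cos PI)) with ((1 - w) / (1 + w))%C in S0.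
2: { unfold poisson; rewrite cos_PI.
     replace (1 - 2 * w * (-1)%R + w * w)%C with ((1 + w) * (1 + w))%C by ring.
     assert (N : (1 + w)%C <> 0).
     { intros E; assert (E1 : Cmod w = 1).
       { replace w with (- (1))%C; [rewrite Cmod_opp; apply Cmod_1 |].
         replace w with (1 + w - 1)%C by ring; rewrite E; ring. }
       assert (H1 := Hv 1 Rlt_0_1); unfold w in E1.
       replace (1 * (2 * PI * Ci * z))%C with (2 * PI * Ci * z)%C in H1 by ring; lra. }
     field; exact N. }
rewrite S0 by (unfold v; rewrite <- RtoC_inv by lra; apply Hv, Rinv_0_lt_compat, PM).
replace (2 ^ S m)%nat with (2 ^ m + 2 ^ m)%nat by (simpl; lia).
(* Reversing the second half aligns the reflected angles: index [2 ^ S m - 1 - k] has the same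
   cosine as index [k]. *)
rewrite Csum_add, <- (Csum_rev (fun k => poisson v (cos (_ + INR (2 ^ m + k) * _ / _)))).
rewrite (Csum_ext (fun k => poisson v (cos (_ + INR (2 ^ m + (_ - 1 - k)) * _ / _)))
  (fun k => poisson v (cos (2 * PI * half_odd k / 2 ^ S m)))).
2: { intros k Hk; f_equal; rewrite <- cos_neg, <- (cos_period _ 1); f_equal.
     replace (2 ^ m + (2 ^ m - 1 - k))%nat with (2 ^ S m - 1 - k)%nat by (simpl; lia).
     rewrite !minus_INR, pow_INR by (simpl; lia); change (INR 2) with 2.
     rewrite half_odd_eq; simpl INR; field; lra. }
rewrite (Csum_ext (fun k => poisson v (cos (_ + INR k * _ / _)))
  (fun k => poisson v (cos (2 * PI * half_odd k / 2 ^ S m)))).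
2: { intros k Hk; do 2 f_equal; rewrite half_odd_eq; field; lra. }
rewrite (Csum_ext (tan_term _ _) (fun j => (- (PI * Ci) * 2 * / (2 ^ S m)%R) *
   poisson v (cos (2 * PI * half_odd j / 2 ^ S m)))%C).
- rewrite Csum_scal; ring.
- intros k Hk; rewrite <- (poisson_chord _ _ _ PM Hz); fold v; ring.
Qed.

Lemma Clim_difference_quotient (f : R -> C) (l : C) (M : nat -> R) :
  f 0 = 0 -> Cder f 0 l -> (forall n, 0 < M n) -> is_lim_seq (fun n => / M n) 0 ->
  Clim eventually (fun n => M n * f (/ M n)%R)%C l.
Proof.
intros H0 [H1 H2] HM HL.
assert (L : forall (g : R -> R) (k : R), g 0 = 0 -> is_derive g 0 k ->
  filterlim (fun n => M n * g (/ M n)) eventually (locally k)).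
{ intros g k G0 Hg; apply is_derive_Reals in Hg; apply filterlim_locally; intros eps.
  destruct (Hg eps (cond_pos eps)) as [d Hd].
  generalize (proj1 (filterlim_locally _ _) HL d); apply filter_imp; intros n Hn.
  change (Rabs (/ M n - 0) < d) in Hn; rewrite Rminus_0_r in Hn.
  assert (P := Rinv_0_lt_compat _ (HM n)).
  assert (Q := Hd (/ M n) ltac:(lra) Hn); rewrite Rplus_0_l, G0, Rminus_0_r in Q.
  change (Rabs (M n * g (/ M n) - k) < eps).
  replace (M n * g (/ M n)) with (g (/ M n) / / M n); [exact Q |].
  field; apply Rgt_not_eq, HM. }
split.
- apply (filterlim_ext (fun n => M n * Re (f (/ M n)))).
  + intros n; simpl; unfold Re; ring.
  + apply (L (fun s => Re (f s))); [rewrite H0; reflexivity | exact H1].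
- apply (filterlim_ext (fun n => M n * Im (f (/ M n)))).
  + intros n; simpl; unfold Im; ring.
  + apply (L (fun s => Im (f s))); [rewrite H0; reflexivity | exact H2].
Qed.

Lemma Clim_chord (z : C) :
  Clim eventually (fun m => chord (2 ^ S m) z) (2 * PI * Ci * z)%C.
Proof.
apply (Clim_ext (fun m => (2 ^ S m)%R *
  (Cexp ((/ 2 ^ S m)%R * (PI * Ci * z)) - Cexp (- ((/ 2 ^ S m)%R * (PI * Ci * z)))))%C).
{ intros m; unfold chord; rewrite RtoC_inv by (apply pow_nonzero; lra); reflexivity. }
apply (Clim_difference_quotient
  (fun s => Cexp (s * (PI * Ci * z)) - Cexp (- (s * (PI * Ci * z))))%C).
- rewrite Cmult_0_l; replace (- 0)%C with (RtoC 0) by ring; ring.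
- eapply Cder_eq; [| apply Cder_minus; apply Cder_Cexp; [| apply Cder_opp]; apply Cder_line].
  cbv beta; rewrite Cmult_0_l; replace (- 0)%C with (RtoC 0) by ring; rewrite Cexp_0; ring.
- intros n; apply pow_lt; lra.
- apply is_lim_seq_ext with (fun n => / 2 * (/ 2) ^ n).
  + intros n; simpl; rewrite pow_inv; field; apply pow_nonzero; lra.
  + replace (Finite 0) with (Rbar_mult (/ 2) 0) by (simpl; f_equal; ring).
    apply is_lim_seq_scal_l, is_lim_seq_geom; rewrite Rabs_right; lra.
Qed.

(** A weak Jordan inequality from [t - t^3 / 6 <= sin t]: as [PI <= 4], [t <= 2], so
    [t^3 / 6 <= 2 t / 3]. *)
Lemma sin_ge_third (t : R) : 0 <= t <= PI / 2 -> t / 3 <= sin t.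
Proof.
intros [H0 H1]; generalize PI_4; intros H4.
destruct (sin_bound t 0 H0 ltac:(lra)) as [B _].
unfold sin_approx, sin_term in B; simpl in B.
apply Rle_trans with (2 := B); apply Rminus_le.
assert (t * t <= 4) by nra; nra.
Qed.

(** The chord has length [2 M sin (PI a / M)]. For [j < 2 ^ m] the angle stays in the first
    quadrant, and [sin t >= t / 3] with [PI > 3] leaves a bound free of [m]; this makes the majorant
    uniform. *)
Lemma Cmod_chord_half_odd (m j : nat) : (j < 2 ^ m)%nat ->
  4 * half_odd j ^ 2 <= Cmod (chord (2 ^ S m) (half_odd j) * chord (2 ^ S m) (half_odd j)).
Proof.
intros Hj; set (M := 2 ^ S m).
assert (PM : 0 < M) by (apply pow_lt; lra).
assert (Ha := half_odd_pos j); set (a := half_odd j) in *.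
assert (HaM : 2 * a <= M).
{ unfold a, M; rewrite half_odd_eq; simpl.
  assert (H : INR (S j) <= INR (2 ^ m)) by (apply le_INR; lia).
  rewrite pow_INR, (S_INR j) in H; change (INR 2) with 2 in H; lra. }
set (t := PI * a / M).
assert (HP := PI_RGT_0); assert (H3 : 3 < PI) by (generalize PI2_3_2; lra).
assert (Ht : 0 <= t <= PI / 2).
{ unfold t; split.
  - apply Rlt_le, Rdiv_lt_0_compat; [apply Rmult_lt_0_compat |]; assumption.
  - apply Rmult_le_reg_r with M; [exact PM |].
    replace (PI * a / M * M) with (PI * a) by (field; lra); nra. }
assert (Hs := sin_ge_third t Ht).
assert (E : chord M a = (0, M * (2 * sin t))).
{ unfold chord.
  replace (/ M * (PI * Ci * a))%C with (RtoC 0 + t * Ci)%C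
    by (unfold t, Rdiv; rewrite !RtoC_mult, RtoC_inv by lra; ring).
  unfold Cexp, RtoC, Ci, Cmult, Cplus, Copp, Cminus; simpl.
  match goal with |- context [cos (- ?u)] => rewrite cos_neg, sin_neg;
    replace u with t by ring end.
  match goal with |- context [exp (- ?u)] => replace u with 0 by ring end.
  rewrite Ropp_0, exp_0; f_equal; ring. }
rewrite E, Cmod_mult.
assert (Hc : M * (2 * sin t) <= Cmod (0, M * (2 * sin t))).
{ apply Rle_trans with (2 := proj2 (re_im_le_Cmod _)); apply Rle_abs. }
assert (Hb : 2 * a <= M * (2 * sin t)).
{ apply Rle_trans with (M * (2 * (t / 3))); [| apply Rmult_le_compat_l; lra].
  replace (M * (2 * (t / 3))) with (2 * PI / 3 * a) by (unfold t; field; lra); nra. }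
nra.
Qed.

(** [half_odd j ^ 2] exceeds [j (j + 1)] by a quarter, which puts the majorant [1 / a^2] in the
    telescoping form of [Csum_tail]. *)
Lemma inv_half_odd_sqr_le (j : nat) : (1 <= j)%nat ->
  / half_odd j ^ 2 <= / INR j - / INR (S j).
Proof.
intros Hj; assert (P : 1 <= INR j) by (apply (le_INR 1); exact Hj).
rewrite half_odd_eq, S_INR.
replace (/ INR j - / (INR j + 1)) with (/ (INR j * (INR j + 1))) by (field; lra).
apply Rinv_le_contravar; nra.
Qed.

Lemma half_odd_sqr_neq (z : C) (j : nat) : Im z <> 0 -> (half_odd j * half_odd j - z * z)%C <> 0.
Proof.
intros Hz E.
replace (half_odd j * half_odd j - z * z)%C
  with ((half_odd j - z) * (half_odd j + z))%C in E by ring.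
revert E; apply Cmult_neq_0; intros E; apply (f_equal Im) in E; destruct z; simpl in *; lra.
Qed.

(** The constant only depends on a bound for [z], so the partial fraction
    expansion converges locally uniformly up to the real axis. *)
Lemma tan_partial_fractions (R0 : R) :
  exists (c : R) (N0 : nat), 0 <= c /\ forall N, (N0 <= N)%nat ->
  forall z : C, Im z < 0 -> Cmod z <= R0 ->
  let w := Cexp (- (2 * PI * Ci * z)) in
  Cmod (Csum (fun j => 2 * z / (half_odd j * half_odd j - z * z))%C N +
        PI * Ci * ((1 - w) / (1 + w))) <= c / INR N.
Proof.
(* The limits of [chord (2 z)] and [chord z] have moduli at most [4 PI R0] and [2 PI R0]; the added
   1 makes the bounds strict, so that they hold for all large [m]. *)
set (c1 := 4 * PI * R0 + 1); set (q := (2 * PI * R0 + 1) ^ 2).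
assert (HP := PI_RGT_0).
destruct (INR_unbounded q) as [N1 HN1].
(* [R0] may be negative here, whence [Rabs]; it is removed once some [z] with [Cmod z <= R0] is
   given. *)
exists (Rabs (PI * c1)), (S N1); split; [apply Rabs_pos |].
intros N HN z Hz Hzb w.
assert (Hz0 := Cmod_ge_0 z).
assert (Hc1 : 0 < c1) by (unfold c1; nra).
rewrite Rabs_right by nra.
assert (Lz := Clim_chord z); assert (L2z := Clim_chord (2 * z)%C).
assert (MPI := Cmod_2_PI_Ci).
assert (Bz : eventually (fun m => Cmod (chord (2 ^ S m) z) < 2 * PI * R0 + 1)).
{ apply (Clim_Cmod_lt _ _ _ _ Lz); rewrite Cmod_mult, MPI; nra. }
assert (B2z : eventually (fun m => Cmod (chord (2 ^ S m) (2 * z)) < c1)).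
{ apply (Clim_Cmod_lt _ _ _ _ L2z).
  rewrite !(Cmod_mult _ (2 * z)), MPI, Cmod_mult, Cmod_R, Rabs_right by lra; unfold c1; nra. }
replace (PI * Ci * ((1 - w) / (1 + w)))%C with (- (- (PI * Ci) * ((1 - w) / (1 + w))))%C by ring.
set (T := (- (PI * Ci) * ((1 - w) / (1 + w)))%C).
(* For each [m] the tangent is the full sum of [2 ^ m] terms, so at fixed [N] only the terms from
   [N] to [2 ^ m] remain to be bounded, independently of [m]. *)
apply (Cmod_le_lim eventually
  (fun m => Csum (tan_term (2 ^ S m) z) N - T)%C (fun _ => PI * c1 / INR N));
  [| apply filterlim_const |].
- apply Clim_minus; [| apply Clim_const].
  apply Clim_sum; intros k _.
  assert (Hk := half_odd_sqr_neq z k ltac:(lra)).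
  unfold tan_term.
  replace (2 * z / (half_odd k * half_odd k - z * z))%C with
    (- (2 * PI * Ci) * (2 * PI * Ci * (2 * z)) /
      (2 * PI * Ci * z * (2 * PI * Ci * z) - 2 * PI * Ci * half_odd k * (2 * PI * Ci * half_odd k)))%C.
  + apply Clim_div.
    * intros E; apply Hk.
      assert (Z := two_PI_Ci_neq0).
      replace (half_odd k * half_odd k - z * z)%C with
       (- ((2 * PI * Ci * z * (2 * PI * Ci * z) -
         2 * PI * Ci * half_odd k * (2 * PI * Ci * half_odd k)) /
         (2 * PI * Ci * (2 * PI * Ci))))%C.
      { rewrite E; field; repeat split; intros E1; apply Z; rewrite E1; ring. }
      field; repeat split; intros E1; apply Z; rewrite E1; ring.
    * apply Clim_mult; [apply Clim_const | exact L2z].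
    * apply Clim_minus; apply Clim_mult; try exact Lz; apply Clim_chord.
  + set (b := (2 * PI * Ci)%C).
    assert (Z : b <> 0) by apply two_PI_Ci_neq0.
    replace (b * z * (b * z) - b * half_odd k * (b * half_odd k))%C with
      (- (b * b) * (half_odd k * half_odd k - z * z))%C by ring.
    field; split; assumption.
- assert (Big : eventually (fun m => (N <= 2 ^ m)%nat)).
  { exists N; intros m Hm; apply Nat.le_trans with (1 := Hm).
    apply Nat.lt_le_incl, Nat.pow_gt_lin_r; lia. }
  generalize (filter_and _ _ Big (filter_and _ _ Bz B2z)); apply filter_imp.
  intros m [Hm [H1 H2]].
  unfold T, w; rewrite (tan_section m z Hz).
  rewrite <- Cmod_opp.
  replace (- (Csum (tan_term (2 ^ S m) z) N - Csum (tan_term (2 ^ S m) z) (2 ^ m)))%C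
    with (Csum (tan_term (2 ^ S m) z) (2 ^ m) - Csum (tan_term (2 ^ S m) z) N)%C by ring.
  apply Csum_tail; [nra | lia | exact Hm |].
  intros j [Hj1 Hj2].
  apply Rle_trans with (PI * c1 * / half_odd j ^ 2);
    [| apply Rmult_le_compat_l; [nra | apply inv_half_odd_sqr_le; lia]].
  assert (Ha := half_odd_pos j).
  (* From here on the pole dominates: the squared chord at [half_odd j] is at least [4 a^2] and the
     one at [z] at most [2 a^2], so the denominator keeps [2 a^2]. *)
  assert (Hq : q <= 2 * half_odd j ^ 2).
  { assert (INR N1 <= INR j) by (apply le_INR; lia).
    assert (1 <= INR j) by (apply (le_INR 1); lia).
    rewrite half_odd_eq; nra. }
  assert (Hd := Cmod_chord_half_odd m j Hj2).
  unfold tan_term.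
  set (u := chord (2 ^ S m) z) in *.
  set (A := (chord (2 ^ S m) (half_odd j) * chord (2 ^ S m) (half_odd j))%C) in *.
  assert (Hu : Cmod (u * u) <= q).
  { rewrite Cmod_mult; unfold q; generalize (Cmod_ge_0 u); nra. }
  assert (Hden : 2 * half_odd j ^ 2 <= Cmod (u * u - A)).
  { assert (Tr := Cmod_triangle (u * u) (- (u * u - A))%C).
    rewrite Cmod_opp in Tr; replace (u * u + - (u * u - A))%C with A in Tr by ring. lra. }
  assert (Hpos : 0 < half_odd j ^ 2) by (apply pow_lt; exact Ha).
  rewrite Cmod_div by (apply Cmod_gt_0; lra).
  rewrite Cmod_mult, Cmod_opp, MPI.
  replace (PI * c1 * / half_odd j ^ 2) with (2 * PI * c1 * / (2 * half_odd j ^ 2))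
    by (field; lra).
  assert (0 < / Cmod (u * u - A)) by (apply Rinv_0_lt_compat; lra).
  assert (/ Cmod (u * u - A) <= / (2 * half_odd j ^ 2)) by (apply Rinv_le_contravar; lra).
  unfold Rdiv; apply Rmult_le_compat; try lra.
  + apply Rmult_le_pos; [lra | apply Cmod_ge_0].
  + apply Rmult_le_compat_l; lra.
Qed.

(** * Derivatives of the partial sums *)

Lemma Csum_geom (y : C) (n : nat) : ((1 - y) * Csum (Cpow y) n)%C = (1 - y ^ n)%C.
Proof.
induction n as [|n IH]; simpl; [ring |].
rewrite Cmult_plus_distr_l, IH; ring.
Qed.

Lemma INR_S_neq0 (n : nat) : RtoC (INR (S n)) <> 0.
Proof. apply RtoC_neq0, not_0_INR; lia. Qed.

(** The polynomial in [LogP] differentiates to the geometric sum [(1 - y^r) / (1 - y)], which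
    cancels the derivative of the logarithm up to [- y^r / (1 - y)]. *)
Lemma Cder_LogP (r : nat) (f : R -> C) (t : R) (a : C) :
  slit (1 - f t) -> Cder f t a ->
  Cder (fun s => LogP r (f s)) t (- (a * f t ^ r / (1 - f t)))%C.
Proof.
intros Hs Hf.
assert (N := slit_neq0 _ Hs).
eapply Cder_eq.
2: { unfold LogP; apply Cder_plus.
     - apply (Cder_CLog (fun s => 1 - f s)%C); [exact Hs |].
       apply Cder_minus; [apply Cder_const | exact Hf].
     - apply (Cder_sum (fun s j => f s ^ S j / INR (S j))%C t (fun j => a * f t ^ j)%C).
       intros k _.
       apply (Cder_ext (fun s => / INR (S k) * f s ^ S k)%C);
         [intros s; unfold Cdiv; apply Cmult_comm |].
       eapply Cder_eq; [| apply Cder_scal, Cder_pow, Hf].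
       field; apply INR_S_neq0. }
rewrite Csum_scal.
replace (Csum (Cpow (f t)) r) with ((1 - f t ^ r) / (1 - f t))%C
  by (rewrite <- Csum_geom; field; exact N).
field; exact N.
Qed.

Definition multicos_term (r : nat) (x : C) (m : nat) : C :=
  ((half_odd m ^ (r - 1))%R *
     (LogP r (2 * x / INR (2 * m + 1)) +
      ((-1) ^ (r - 1))%R * LogP r (- (2 * x / INR (2 * m + 1)))))%C.

Lemma multicosE (r : nat) (x : C) : multicos r x = Cexp (CSeries (multicos_term r x)).
Proof. reflexivity. Qed.

Lemma half_odd_div (x : C) (m : nat) : (2 * x / INR (2 * m + 1))%C = (x / half_odd m)%C.
Proof.
unfold half_odd; unfold Rdiv; rewrite RtoC_mult, RtoC_inv by lra.
assert (INR (2 * m + 1) <> 0) by (apply not_0_INR; lia).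
field; apply RtoC_neq0; assumption.
Qed.

(** The sign [(-1)^(r-1)] makes the two derivatives add up over the common denominator [1 - y^2],
    and the weight [half_odd m ^ (r - 1)] clears the denominators of [y^(r-1)]. A common factor
    times a partial fraction of the tangent is left. *)
Lemma Cder_multicos_term (r : nat) (z : C) (t : R) (m : nat) : (1 <= r)%nat ->
  slit (1 - t * z / half_odd m) -> slit (1 + t * z / half_odd m) ->
  Cder (fun s => multicos_term r (s * z) m) t
   (- (z * (t * z) ^ (r - 1) *
       (2 * (t * z) / (half_odd m * half_odd m - t * z * (t * z)))))%C.
Proof.
intros Hr H1 H2; unfold multicos_term.
set (a := half_odd m) in *.
assert (Ha : RtoC a <> 0) by (apply RtoC_neq0, Rgt_not_eq, half_odd_pos).
assert (L : Cder (fun s => 2 * (s * z) / INR (2 * m + 1))%C t (z / a)%C).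
{ apply (Cder_ext (fun s => s * (z / a))%C); [| apply Cder_line].
  intros s; rewrite half_odd_div; fold a; field; exact Ha. }
assert (E : (2 * (t * z) / INR (2 * m + 1))%C = (t * z / a)%C) by apply half_odd_div.
eapply Cder_eq.
2: { apply Cder_scal, Cder_plus; [| apply Cder_scal]; apply Cder_LogP.
     - rewrite E; exact H1.
     - exact L.
     - rewrite E; replace (1 - - (t * z / a))%C with (1 + t * z / a)%C by ring; exact H2.
     - apply Cder_opp, L. }
cbv beta; rewrite E; set (y := (t * z / a)%C) in *.
assert (N1 := slit_neq0 _ H1); assert (N2 := slit_neq0 _ H2).
assert (Ey : (t * z)%C = (a * y)%C) by (unfold y; field; exact Ha).
rewrite !Ey.
destruct r as [|s]; [lia |]; replace (S s - 1)%nat with s by lia.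
replace ((- y) ^ S s)%C with (- (((-1) ^ s)%R * y ^ S s))%C.
2: { replace (- y)%C with (RtoC (-1) * y)%C by ring; rewrite Cpow_mult_l, <- RtoC_pow; simpl pow.
     rewrite RtoC_mult; ring. }
assert (S2 : (RtoC ((-1) ^ s) * RtoC ((-1) ^ s))%C = 1).
{ rewrite <- RtoC_mult, <- Rpow_mult_distr; f_equal.
  replace (-1 * -1) with 1 by ring; apply pow1. }
rewrite Cpow_mult_l, <- RtoC_pow; simpl Cpow.
set (e := RtoC ((-1) ^ s)) in *.
replace (a * a - a * y * (a * y))%C with (a * a * ((1 - y) * (1 + y)))%C by ring.
replace (1 - - y)%C with (1 + y)%C by ring.
replace (e * - (- (z / a) * - (e * (y * y ^ s)) / (1 + y)))%C with
  (- (e * e * (z / a * (y * y ^ s) / (1 + y))))%C by (field; repeat split; assumption).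
rewrite S2; field; repeat split; assumption.
Qed.

Definition Li_part (k : nat) (z : C) (M : nat) : C :=
  Csum (fun n => z ^ S n / (INR (S n) ^ k)%R)%C M.

Lemma LiE (k : nat) (z : C) : Li k z = CSeries (fun n => z ^ S n / (INR (S n) ^ k)%R)%C.
Proof. reflexivity. Qed.

Lemma Cder_Li_part (k M : nat) (x : C) (t : R) :
  Cder (fun s => Li_part (S k) (- Cexp (- (PI * Ci * (s * x)))) M) t
    (- (PI * Ci * x) * Li_part k (- Cexp (- (PI * Ci * (t * x)))) M)%C.
Proof.
set (E := fun s : R => (- Cexp (- (PI * Ci * (s * x))))%C).
assert (HE : Cder E t (- (PI * Ci * x) * E t)%C).
{ eapply Cder_eq.
  2: { unfold E; apply Cder_opp, Cder_Cexp, Cder_opp.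
       apply Cder_scal, Cder_line. }
  unfold E; ring. }
change (fun s => Li_part (S k) (- Cexp (- (PI * Ci * (s * x)))) M)
  with (fun s => Li_part (S k) (E s) M); fold (E t).
unfold Li_part; rewrite <- Csum_scal.
apply Cder_sum; intros n _.
apply (Cder_ext (fun s => / (INR (S n) ^ S k)%R * E s ^ S n)%C).
{ intros s; unfold Cdiv; apply Cmult_comm. }
eapply Cder_eq; [| apply Cder_scal, Cder_pow, HE].
change (INR (S n) ^ S k)%R with (INR (S n) * INR (S n) ^ k)%R.
rewrite RtoC_mult.
change (E t ^ S n)%C with (E t * E t ^ n)%C.
field; split; [apply RtoC_neq0, pow_nonzero, not_0_INR; lia | apply INR_S_neq0].
Qed.

Lemma Li_part_0 (z : C) (M : nat) : z <> 1 ->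
  Li_part 0 z M = (z * (1 - z ^ M) / (1 - z))%C.
Proof.
intros Hz.
assert (N : (1 - z)%C <> 0).
{ intros E; apply Hz; replace z with (1 - (1 - z))%C by ring; rewrite E; ring. }
unfold Li_part; rewrite (Csum_ext _ (fun n => z * z ^ n)%C).
- rewrite Csum_scal.
  replace (Csum (Cpow z) M) with ((1 - z ^ M) / (1 - z))%C
    by (rewrite <- Csum_geom; field; exact N).
  field; exact N.
- intros k _; simpl pow; simpl Cpow; field.
Qed.

(** Differentiating the product [Li_(r-k) * x^k] gives two terms, and the sum
    over [k] telescopes. *)
Lemma Cder_Li_sum (r K M : nat) (x : C) (t : R) : (K < r)%nat ->
  Cder (fun s => Csum (fun k => (PI * Ci) ^ k / INR (fact k) *
           Li_part (r - k) (- Cexp (- (PI * Ci * (s * x)))) M * (s * x) ^ k) (S K))%C t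
    (- ((PI * Ci) ^ S K / INR (fact K) * x * (t * x) ^ K *
        Li_part (r - S K) (- Cexp (- (PI * Ci * (t * x)))) M))%C.
Proof.
induction K as [|K IH]; intros HK.
- apply (Cder_ext (fun s => Li_part (S (r - 1)) (- Cexp (- (PI * Ci * (s * x)))) M)).
  { intros s; simpl; replace (S (r - 1)) with (r - 0)%nat by lia; field. }
  eapply Cder_eq; [| apply Cder_Li_part].
  simpl; field.
- set (u := fun (s : R) k => ((PI * Ci) ^ k / INR (fact k) *
           Li_part (r - k) (- Cexp (- (PI * Ci * (s * x)))) M * (s * x) ^ k)%C) in *.
  apply (Cder_ext (fun s => Csum (u s) (S K) + u s (S K))%C); [reflexivity |].
  eapply Cder_eq.
  2: { apply Cder_plus; [apply IH; lia |].
       unfold u; apply Cder_mult; [apply Cder_scal | apply Cder_pow, Cder_line].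
       replace (r - S K)%nat with (S (r - S (S K))) by lia; apply Cder_Li_part. }
  cbv beta; replace (r - S K)%nat with (S (r - S (S K))) by lia.
  rewrite fact_simpl, mult_INR, RtoC_mult; simpl Cpow.
  field; split; [apply RtoC_neq0, INR_fact_neq_0 | apply INR_S_neq0].
Qed.

(** * The closed form and its derivative *)

Definition coef (r : nat) : C := (INR (fact (r - 1)) / (2 * PI * Ci) ^ (r - 1))%C.

(** The polylogarithm is a parameter: [Li] gives the exponent of the theorem, [Li_part] a finite sum
    that can be differentiated. *)
Definition lower_exponent_with (L : nat -> C -> C) (r : nat) (x : C) : C :=
  (- coef r * Csum (fun k => (PI * Ci) ^ k / INR (fact k) *
       L (r - k)%nat (- Cexp (- (PI * Ci * x))) * x ^ k) r
   + PI * Ci / INR r * (x / 2) ^ r - coef r * zetaE r)%C.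

Definition lower_exponent : nat -> C -> C := lower_exponent_with Li.

(** After telescoping, [coef r] reduces the remaining factor [(pi i)^r / (r-1)!] to
    [pi i / 2^(r-1)]. The monomial contributes the [/ 2], which completes [Li_0 (- w)] to
    [(1 - w) / (2 (1 + w))], half of [i] times the tangent. *)
Lemma Cder_lower_part (r M : nat) (x : C) (t : R) : (1 <= r)%nat ->
  Cder (fun s => lower_exponent_with (fun k z => Li_part k z M) r (s * x)) t
    (PI * Ci * x * (t * x / 2) ^ (r - 1) *
       (Li_part 0 (- Cexp (- (PI * Ci * (t * x)))) M + / 2))%C.
Proof.
intros Hr; destruct r as [|q]; [lia |].
unfold lower_exponent_with.
eapply Cder_eq.
2: { apply Cder_minus; [apply Cder_plus; apply Cder_scal | apply Cder_const].
     - apply (Cder_Li_sum (S q) q M x t); lia.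
     - apply (Cder_ext (fun s => (s * (x / 2)) ^ S q)%C).
       + intros s; f_equal; unfold Cdiv; ring.
       + apply Cder_pow, Cder_line. }
unfold coef; replace (S q - 1)%nat with q by lia; replace (S q - S q)%nat with O by lia.
unfold Cdiv; rewrite !Cpow_mult_l, !Cpow_S, !Cpow_inv by (apply RtoC_neq0; lra).
assert (HP : (PI ^ q)%C <> 0) by (apply Cpow_nz, RtoC_neq0, PI_neq0).
assert (HI : (Ci ^ q)%C <> 0).
{ apply Cpow_nz; intros E; apply (f_equal Im) in E; simpl in E; lra. }
assert (H2 : (2 ^ q)%C <> 0) by (apply Cpow_nz, RtoC_neq0; lra).
field; repeat split; try assumption; try apply INR_S_neq0;
  apply RtoC_neq0, INR_fact_neq_0.
Qed.

Lemma Cmod_Cexp_lt1 (x : C) (d : R) : Im x < 0 -> 0 < d ->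
  Cmod (- Cexp (- (PI * Ci * (d * x)))) < 1.
Proof.
intros Hx Hd; rewrite Cmod_opp, Cmod_Cexp, <- exp_0; apply exp_increasing.
destruct x as [u v]; simpl in *; generalize PI_RGT_0; intros HP.
assert (0 < PI * d) by nra; nra.
Qed.

Lemma Cmod_Cexp_decr (x : C) (d t : R) : Im x < 0 -> 0 < d <= t ->
  Cmod (- Cexp (- (PI * Ci * (t * x)))) <= Cmod (- Cexp (- (PI * Ci * (d * x)))).
Proof.
intros Hx [Hd Ht]; rewrite !Cmod_opp, !Cmod_Cexp.
destruct (Rle_lt_or_eq_dec _ _ Ht) as [Hlt | <-]; [| right; reflexivity].
apply Rlt_le, exp_increasing; destruct x as [u v]; simpl in *; generalize PI_RGT_0; intros HP.
assert (0 < PI * (t - d)) by nra; nra.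
Qed.

Lemma Cmod_one_minus_ge (y : C) : 1 - Cmod y <= Cmod (1 - y).
Proof.
assert (T := Cmod_triangle (1 - y) y); replace (1 - y + y)%C with (RtoC 1) in T by ring.
rewrite Cmod_1 in T; lra.
Qed.

Lemma slit_nonreal (z : C) (m : nat) : Im z <> 0 ->
  slit (1 - z / half_odd m) /\ slit (1 + z / half_odd m).
Proof.
intros Hz; assert (Ha := half_odd_pos m).
replace (z / half_odd m)%C with (z * (/ half_odd m)%R)%C by (rewrite RtoC_inv by lra; reflexivity).
assert (P := Rinv_0_lt_compat _ Ha).
split; right; destruct z as [u v]; simpl in *; intros E; apply Hz; nra.
Qed.

(** The derivative of [F] is the partial fraction error [K] plus the geometric tail of [Li_0]. The
    modulus [rho] at the left end [d] bounds the ratio on the whole of [[d, 1]], and it tends to 1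
    with [d]. *)
Lemma increment_bound (r N M : nat) (x : C) (d R0 K : R) :
  (1 <= r)%nat -> Im x < 0 -> Cmod (x / 2) <= R0 -> 0 < d <= 1 -> 0 <= K ->
  (forall z : C, Im z < 0 -> Cmod z <= R0 ->
    let w := Cexp (- (2 * PI * Ci * z)) in
    Cmod (Csum (fun j => 2 * z / (half_odd j * half_odd j - z * z))%C N +
          PI * Ci * ((1 - w) / (1 + w))) <= K) ->
  let F := fun s : R => (Csum (multicos_term r (s * (x / 2))) N -
             lower_exponent_with (fun k z => Li_part k z M) r (s * x))%C in
  let rho := Cmod (- Cexp (- (PI * Ci * (d * x)))) in
  Cmod (F 1 - F d) <= 2 * (R0 ^ r * (K + 2 * PI * (rho ^ S M / (1 - rho)))).
Proof.
intros Hr Hx HR Hd HK Hpf F rho.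
assert (HP := PI_RGT_0).
assert (Hrho : 0 <= rho < 1) by (split; [apply Cmod_ge_0 | apply Cmod_Cexp_lt1; lra]).
assert (HR0 : 0 <= R0) by (generalize (Cmod_ge_0 (x / 2)); lra).
set (B := R0 ^ r * (K + 2 * PI * (rho ^ S M / (1 - rho)))).
assert (HB : 0 <= B).
{ unfold B; apply Rmult_le_pos; [apply pow_le, HR0 |].
  assert (0 <= rho ^ S M / (1 - rho)).
  { apply Rmult_le_pos; [apply pow_le; lra | apply Rlt_le, Rinv_0_lt_compat; lra]. }
  nra. }
apply Rle_trans with (2 * B * (1 - d)); [| nra].
pose (F' := fun t : R => (- (x / 2 * (t * (x / 2)) ^ (r - 1) *
   (Csum (fun j => 2 * (t * (x / 2)) /
       (half_odd j * half_odd j - t * (x / 2) * (t * (x / 2))))%C N +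
    2 * PI * Ci * (Li_part 0 (- Cexp (- (PI * Ci * (t * x)))) M + / 2))))%C).
assert (Imt : forall t, 0 < t -> Im (t * (x / 2)) < 0).
{ intros t Ht; replace (t * (x / 2))%C with ((t * / 2)%R * x)%C
    by (rewrite RtoC_mult, RtoC_inv by lra; unfold Cdiv; ring).
  destruct x as [u v]; simpl in *; nra. }
apply (Cmod_mean_value F F'); [lra | |].
- intros t Ht; unfold F.
  assert (It := Imt t ltac:(lra)).
  eapply Cder_eq.
  2: { apply Cder_minus; [| apply Cder_lower_part, Hr].
       apply (Cder_sum (fun s m => multicos_term r (s * (x / 2)) m) t
         (fun m => - (x / 2) * (t * (x / 2)) ^ (r - 1) * (2 * (t * (x / 2)) /
           (half_odd m * half_odd m - t * (x / 2) * (t * (x / 2)))))%C).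
       intros m _; destruct (slit_nonreal (t * (x / 2)) m ltac:(lra)) as [S1 S2].
       eapply Cder_eq; [| apply Cder_multicos_term; assumption].
       ring. }
  unfold F'; rewrite (Csum_scal (- (x / 2) * (t * (x / 2)) ^ (r - 1))%C).
  replace (t * x / 2)%C with (t * (x / 2))%C by (unfold Cdiv; ring).
  field.
- intros t Ht; unfold F'; rewrite Cmod_opp.
  set (z := (t * (x / 2))%C); assert (It := Imt t ltac:(lra)); fold z in It.
  assert (Hz : Cmod z <= R0).
  { unfold z; rewrite Cmod_mult, Cmod_R, Rabs_right by lra.
    generalize (Cmod_ge_0 (x / 2)); nra. }
  set (w := Cexp (- (PI * Ci * (t * x)))).
  assert (Ew : Cexp (- (2 * PI * Ci * z)) = w) by (unfold w, z; f_equal; field).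
  assert (Hpz := Hpf z It Hz); cbv zeta in Hpz; rewrite Ew in Hpz.
  assert (Hw : Cmod (- w) <= rho) by (apply Cmod_Cexp_decr; lra).
  assert (Hw1 := Cmod_one_minus_ge (- w)).
  assert (N1 : (1 - - w)%C <> 0) by (apply Cmod_gt_0; lra).
  rewrite Li_part_0 by (intros E; apply N1; rewrite E; ring).
  match goal with |- Cmod (_ * (?S + _)) <= _ => set (Sg := S) in * end.
  (* Separates the complete [Li_0], which together with the [/ 2] meets the partial fraction bound,
     from the tail cut off at [M]. *)
  replace (Sg + 2 * PI * Ci * (- w * (1 - (- w) ^ M) / (1 - - w) + / 2))%C with
    (Sg + PI * Ci * ((1 - w) / (1 + w)) - 2 * PI * Ci * ((- w) ^ S M / (1 - - w)))%C.
  2: { replace (1 - - w)%C with (1 + w)%C in * by ring; simpl Cpow; field; exact N1. }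
  assert (H1 : Cmod ((- w) ^ S M / (1 - - w)) <= rho ^ S M / (1 - rho)).
  { rewrite Cmod_div by exact N1; rewrite Cmod_pow.
    apply Rmult_le_compat.
    - apply pow_le, Cmod_ge_0.
    - apply Rlt_le, Rinv_0_lt_compat; lra.
    - apply pow_incr; split; [apply Cmod_ge_0 | exact Hw].
    - apply Rinv_le_contravar; lra. }
  assert (MPI := Cmod_2_PI_Ci).
  unfold B; rewrite Cmod_mult.
  apply Rmult_le_compat; try apply Cmod_ge_0.
  + rewrite Cmod_mult, Cmod_pow; replace r with (S (r - 1)) at 2 by lia; simpl.
    apply Rmult_le_compat; try apply Cmod_ge_0; [apply pow_le, Cmod_ge_0 | exact HR |].
    apply pow_incr; split; [apply Cmod_ge_0 | exact Hz].
  + apply Rle_trans with (1 := Cmod_triangle _ _).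
    rewrite Cmod_opp, (Cmod_mult (2 * PI * Ci)), MPI.
    apply Rplus_le_compat; [exact Hpz | apply Rmult_le_compat_l; lra].
Qed.

(** * Polylogarithms *)

Lemma is_lim_seq_pow_S (q : R) : 0 <= q < 1 -> is_lim_seq (fun n => q ^ S n) 0.
Proof.
intros Hq; replace (Finite 0) with (Rbar_mult q 0) by (simpl; f_equal; ring).
apply (is_lim_seq_scal_l (fun n => q ^ n)), is_lim_seq_geom; rewrite Rabs_right; lra.
Qed.

Lemma Cmod_Li_term (k n : nat) (y : C) :
  Cmod (y ^ S n / (INR (S n) ^ k)%R) = Cmod y ^ S n / INR (S n) ^ k.
Proof.
assert (P : 0 < INR (S n) ^ k) by (apply pow_lt, lt_0_INR; lia).
rewrite Cmod_div by (apply RtoC_neq0; lra).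
rewrite Cmod_pow, Cmod_R, Rabs_right by lra; reflexivity.
Qed.

Lemma INR_S_pow_ge (n j k : nat) : (j <= k)%nat -> INR (S n) ^ j <= INR (S n) ^ k.
Proof. intros H; apply Rle_pow; [apply (le_INR 1); lia | exact H]. Qed.

Lemma Clim_Li_part (k : nat) (y : C) : Cmod y < 1 -> Clim eventually (Li_part k y) (Li k y).
Proof.
intros Hy; rewrite LiE; apply Clim_CSeries with (fun n => Cmod y ^ n).
- intros n; rewrite Cmod_Li_term; assert (H0 := Cmod_ge_0 y).
  assert (P := INR_S_pow_ge n 0 k ltac:(lia)); simpl (_ ^ 0) in P.
  assert (Q := pow_le _ n H0).
  apply Rmult_le_reg_r with (INR (S n) ^ k); [lra |].
  unfold Rdiv; rewrite Rmult_assoc, Rinv_l, Rmult_1_r by lra.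
  change (Cmod y ^ S n) with (Cmod y * Cmod y ^ n); nra.
- apply ex_series_geom; rewrite Rabs_right; [exact Hy | apply Rle_ge, Cmod_ge_0].
Qed.

Lemma ex_series_inv_sqr : ex_series (fun n => / INR (S n) ^ 2).
Proof.
apply (@ex_series_le R_AbsRing R_CompleteNormedModule) with
  (fun n => 2 * (/ INR (S n) - / INR (S (S n)))).
- intros n; change (norm (/ INR (S n) ^ 2)) with (Rabs (/ INR (S n) ^ 2)).
  assert (P : 1 <= INR (S n)) by (apply (le_INR 1); lia).
  rewrite (S_INR (S n)); set (a := INR (S n)) in *.
  assert (Q : 0 < a ^ 2) by (apply pow_lt; lra).
  rewrite Rabs_right by (apply Rle_ge, Rlt_le, Rinv_0_lt_compat, Q).
  replace (2 * (/ a - / (a + 1))) with (/ (a * (a + 1) / 2)) by (field; lra).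
  apply Rinv_le_contravar; nra.
- exists 2.
  change (is_lim_seq (sum_n (fun n => 2 * (/ INR (S n) - / INR (S (S n))))) 2).
  apply (is_lim_seq_ext (fun n => 2 * (1 - / INR (S (S n))))).
  + intros n; induction n as [|n IH].
    * rewrite sum_O; simpl; field.
    * rewrite sum_Sn, <- IH.
      rewrite (S_INR (S (S n))); assert (INR (S (S n)) <> 0) by (apply not_0_INR; lia).
      unfold plus; simpl; ring.
  + replace (Finite 2) with (Rbar_mult 2 (Rbar_minus 1 0)) by (simpl; f_equal; ring).
    apply is_lim_seq_scal_l, is_lim_seq_minus'; [apply is_lim_seq_const |].
    replace (Finite 0) with (Rbar_inv p_infty) by reflexivity.
    apply is_lim_seq_inv; [| discriminate].
    apply (is_lim_seq_incr_1 (fun n => INR (S n))), (is_lim_seq_incr_1 INR), is_lim_seq_INR.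
Qed.

(** For [k >= 2] the majorant [1 / n^2] holds on the closed unit disc, so continuity includes the
    circle onto which the exponential maps the real axis. *)
Lemma Clim_Li {T} (F : (T -> Prop) -> Prop) {FF : ProperFilter F} (k : nat) (f : T -> C) (y : C) :
  (2 <= k)%nat -> F (fun t => Cmod (f t) <= 1) -> Clim F f y ->
  Clim F (fun t => Li k (f t)) (Li k y).
Proof.
intros Hk Hf Hy.
apply (Clim_CSeries_dominated F (fun t n => f t ^ S n / (INR (S n) ^ k)%R)%C
  (fun n => y ^ S n / (INR (S n) ^ k)%R)%C (fun n => / INR (S n) ^ 2)).
- revert Hf; apply filter_imp; intros t Ht n; rewrite Cmod_Li_term.
  assert (P := INR_S_pow_ge n 2 k Hk).
  assert (P2 : 0 < INR (S n) ^ 2) by (apply pow_lt, lt_0_INR; lia).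
  assert (Q : Cmod (f t) ^ S n <= 1).
  { rewrite <- (pow1 (S n)); apply pow_incr; split; [apply Cmod_ge_0 | exact Ht]. }
  assert (Q0 := pow_le _ (S n) (Cmod_ge_0 (f t))).
  unfold Rdiv; rewrite <- (Rmult_1_l (/ INR (S n) ^ 2)).
  apply Rmult_le_compat; [exact Q0 | apply Rlt_le, Rinv_0_lt_compat; lra | exact Q |].
  apply Rinv_le_contravar; assumption.
- exact ex_series_inv_sqr.
- intros n; apply Clim_div; [| apply Clim_pow, Hy | apply Clim_const].
  apply RtoC_neq0, pow_nonzero, not_0_INR; lia.
Qed.

Lemma CLog_1 : CLog 1 = 0.
Proof.
unfold CLog; rewrite Cmod_1, ln_1, Carg_re_pos by (simpl; lra).
simpl; unfold Rdiv; rewrite Rmult_0_l, atan_0; reflexivity.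
Qed.

Lemma LogP_0 (r : nat) : LogP r 0 = 0.
Proof.
unfold LogP; replace (1 - 0)%C with (RtoC 1) by ring; rewrite CLog_1.
assert (E : forall n, Csum (fun j => 0 ^ S j / INR (S j))%C n = 0).
{ induction n as [|n IH]; [reflexivity |].
  change (Csum (fun j => 0 ^ S j / INR (S j))%C n + 0 ^ S n / INR (S n) = 0)%C.
  rewrite IH, Cpow_S; unfold Cdiv; ring. }
change (0 + Csum (fun j => 0 ^ S j / INR (S j))%C r = 0)%C; rewrite E; ring.
Qed.

(** [LogP M y] is exactly the remainder of the Taylor series of the logarithm, and its derivative
    [- y^M / (1 - y)] is geometrically small on the segment from 0 to [y]. *)
Lemma Li_1 (y : C) : Cmod y < 1 -> Li 1 y = (- CLog (1 - y))%C.
Proof.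
intros Hy; assert (H0 := Cmod_ge_0 y); rewrite LiE; apply CSeries_unique.
apply (Clim_of_Cmod eventually _ _ (fun M => 2 * (Cmod y ^ S M / (1 - Cmod y)) * (1 - 0))).
- apply filter_forall; intros M.
  replace (Csum (fun n => y ^ S n / (INR (S n) ^ 1)%R)%C M - - CLog (1 - y))%C
    with (LogP M (1%R * y) - LogP M (0%R * y))%C.
  2: { rewrite Cmult_0_l, LogP_0, Cmult_1_l; unfold LogP.
       rewrite (Csum_ext (fun n => y ^ S n / (INR (S n) ^ 1)%R)%C
         (fun j => Defs.Cpow y (S j) / INR (S j))%C); [ring |].
       intros k _; rewrite pow_1; reflexivity. }
  assert (Hs : forall t, 0 <= t <= 1 -> Cmod (t * y) <= Cmod y).
  { intros t Ht; rewrite Cmod_mult, Cmod_R, Rabs_right by lra; nra. }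
  assert (Hm : forall t, 0 <= t <= 1 -> 1 - Cmod y <= Cmod (1 - t * y)).
  { intros t Ht; apply Rle_trans with (2 := Cmod_one_minus_ge _).
    generalize (Hs t Ht); lra. }
  apply (Cmod_mean_value (fun s => LogP M (s * y))
    (fun t => - (y * (t * y) ^ M / (1 - t * y)))%C); [lra | |]; intros t Ht.
  + apply (Cder_LogP M (fun s => s * y)%C); [left | apply Cder_line].
    generalize (proj1 (re_im_le_Cmod (t * y))) (Hs t Ht); intros A1 A2.
    generalize (Rle_abs (Re (t * y))); simpl in *; unfold Re in *; lra.
  + assert (N := Hm t Ht).
    rewrite Cmod_opp, Cmod_div, Cmod_mult, Cmod_pow by (apply Cmod_gt_0; lra).
    unfold Rdiv; apply Rmult_le_compat.
    * apply Rmult_le_pos; [exact H0 | apply pow_le, Cmod_ge_0].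
    * apply Rlt_le, Rinv_0_lt_compat; lra.
    * apply Rmult_le_compat_l; [exact H0 |].
      apply pow_incr; split; [apply Cmod_ge_0 | apply Hs, Ht].
    * apply Rinv_le_contravar; lra.
- change (is_lim_seq (fun M => 2 * (Cmod y ^ S M / (1 - Cmod y)) * (1 - 0)) 0).
  apply is_lim_seq_ext with (fun M => (2 / (1 - Cmod y)) * Cmod y ^ S M);
    [intros M; unfold Rdiv; ring |].
  replace (Finite 0) with (Rbar_mult (2 / (1 - Cmod y)) 0) by (simpl; f_equal; ring).
  apply is_lim_seq_scal_l, is_lim_seq_pow_S; lra.
Qed.

(** * The estimate in the lower half-plane *)

(** In the closed lower half-plane [Li_1] is replaced by the logarithm, which
    stays continuous up to the real axis. *)
Definition boundary_exponent (r : nat) (x : C) : C :=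
  (- coef r * (Csum (fun k => (PI * Ci) ^ k / INR (fact k) *
       Li (r - k) (- Cexp (- (PI * Ci * x))) * x ^ k) (r - 1)
     - (PI * Ci) ^ (r - 1) / INR (fact (r - 1)) *
       CLog (1 + Cexp (- (PI * Ci * x))) * x ^ (r - 1))
   + PI * Ci / INR r * (x / 2) ^ r - coef r * zetaE r)%C.

Lemma lower_exponent_boundary (r : nat) (x : C) : (1 <= r)%nat -> Im x < 0 ->
  lower_exponent r x = boundary_exponent r x.
Proof.
intros Hr Hx; unfold lower_exponent, lower_exponent_with, boundary_exponent.
destruct r as [|q]; [lia |]; replace (S q - 1)%nat with q by lia.
cbn [Csum]; replace (S q - q)%nat with 1%nat by lia.
rewrite Li_1.
- replace (1 - - Cexp (- (PI * Ci * x)))%C with (1 + Cexp (- (PI * Ci * x)))%C by ring; ring.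
- generalize (Cmod_Cexp_lt1 x 1 Hx Rlt_0_1); rewrite Cmult_1_l; trivial.
Qed.

Lemma Clim_boundary_exponent {T} (F : (T -> Prop) -> Prop) {FF : ProperFilter F}
  (r : nat) (f : T -> C) (l : C) :
  F (fun t => Im (f t) < 0) -> Clim F f l -> 0 < Re (1 + Cexp (- (PI * Ci * l))) ->
  Clim F (fun t => boundary_exponent r (f t)) (boundary_exponent r l).
Proof.
intros HF Hf Hl; unfold boundary_exponent.
assert (HE : Clim F (fun t => Cexp (- (PI * Ci * f t))) (Cexp (- (PI * Ci * l)))).
{ apply Clim_Cexp, Clim_opp, Clim_mult; [apply Clim_const | exact Hf]. }
repeat first [apply Clim_minus | apply Clim_plus]; try apply Clim_const.
- apply Clim_mult; [apply Clim_const |]; apply Clim_minus.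
  + apply Clim_sum; intros k Hk.
    apply Clim_mult; [apply Clim_mult; [apply Clim_const |] | apply Clim_pow, Hf].
    apply (Clim_Li F); [lia | | apply Clim_opp, HE].
    revert HF; apply filter_imp; intros t Ht.
    generalize (Cmod_Cexp_lt1 (f t) 1 Ht Rlt_0_1); rewrite Cmult_1_l; apply Rlt_le.
  + apply Clim_mult; [apply Clim_mult; [apply Clim_const |] | apply Clim_pow, Hf].
    apply (Clim_CLog F); [exact Hl |]; apply Clim_plus; [apply Clim_const | exact HE].
- apply Clim_mult; [apply Clim_const |]; apply Clim_pow, Clim_mult;
    [exact Hf | apply Clim_const].
Qed.

Lemma Li_opp_1 (k : nat) : Li k (- (1)) = (- zetaE k)%C.
Proof.
rewrite LiE; unfold CSeries, zetaE.
assert (E : forall n, ((- (1)) ^ S n / (INR (S n) ^ k)%R)%C = RtoC (- ((-1) ^ n / INR (S n) ^ k))).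
{ intros n; replace (- (1))%C with (RtoC (-1)) by (rewrite <- RtoC_opp; f_equal; ring).
  rewrite <- RtoC_pow; unfold Rdiv.
  assert (P : INR (S n) ^ k <> 0) by (apply pow_nonzero, not_0_INR; lia).
  unfold Cdiv; rewrite <- RtoC_inv by exact P; rewrite <- RtoC_mult; f_equal; simpl; ring. }
rewrite (Series_ext _ (fun n => - ((-1) ^ n / INR (S n) ^ k))) by (intros n; rewrite E; reflexivity).
rewrite (Series_ext (fun n => Im _) (fun n => 0 * 0)) by (intros n; rewrite E; simpl; ring).
rewrite Series_scal_l, Rmult_0_l, Series_opp, <- RtoC_opp; reflexivity.
Qed.

(** Only [k = 0] survives at the origin, where [Li_r (-1) = - zetaE r]: the last term of the closed
    form is the constant of integration. *)
Lemma boundary_exponent_0 (r : nat) : (2 <= r)%nat -> boundary_exponent r 0 = 0.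
Proof.
intros Hr; unfold boundary_exponent.
destruct r as [|[|q]]; [lia | lia |]; replace (S (S q) - 1)%nat with (S q) by lia.
rewrite Csum_S_l.
rewrite (Csum_ext _ (fun _ => 0 * 0)%C q).
- rewrite Csum_scal, Nat.sub_0_r.
  replace (- (PI * Ci * 0))%C with (RtoC 0) by ring; rewrite Cexp_0, Li_opp_1.
  rewrite !Cpow_S; change ((PI * Ci) ^ 0)%C with (RtoC 1); change (0 ^ 0)%C with (RtoC 1).
  change (INR (fact 0)) with 1.
  field; split; [apply INR_S_neq0 | apply RtoC_neq0, INR_fact_neq_0].
- intros k Hk; rewrite (Cpow_S 0); ring.
Qed.

Lemma multicos_term_0 (r m : nat) : multicos_term r 0 m = 0.
Proof.
unfold multicos_term; replace (2 * 0 / INR (2 * m + 1))%C with (RtoC 0) by (unfold Cdiv; ring).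
replace (- 0)%C with (RtoC 0) by ring; rewrite LogP_0; ring.
Qed.

Lemma Clim_LogP {T} (F : (T -> Prop) -> Prop) {FF : Filter F} (r : nat) (f : T -> C) (l : C) :
  0 < Re (1 - l) -> Clim F f l -> Clim F (fun t => LogP r (f t)) (LogP r l).
Proof.
intros Hl Hf; apply Clim_plus.
- apply (Clim_CLog F); [exact Hl |]; apply Clim_minus; [apply Clim_const | exact Hf].
- apply Clim_sum; intros k _; apply Clim_mult; [apply (Clim_pow f l (S k)), Hf | apply Clim_const].
Qed.

Lemma Clim_multicos_term {T} (F : (T -> Prop) -> Prop) {FF : Filter F}
  (r m : nat) (f : T -> C) (x : R) :
  -1 < x < 1 -> Clim F f (x / 2)%C ->
  Clim F (fun t => multicos_term r (f t) m) (multicos_term r (x / 2) m).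
Proof.
intros Hx Hf.
assert (Ha : / 2 <= half_odd m) by (rewrite half_odd_eq; generalize (pos_INR m); lra).
assert (E : (2 * (x / 2) / INR (2 * m + 1))%C = RtoC (x / 2 / half_odd m)).
{ rewrite half_odd_div; unfold Cdiv, Rdiv; rewrite !RtoC_mult, !RtoC_inv by lra; reflexivity. }
assert (B : -1 < x / 2 / half_odd m < 1).
{ assert (P := inv_half_odd_le m).
  unfold Rdiv; split; nra. }
assert (L : Clim F (fun t => 2 * f t / INR (2 * m + 1))%C (2 * (x / 2) / INR (2 * m + 1))%C).
{ apply Clim_mult; [apply Clim_mult; [apply Clim_const | exact Hf] | apply Clim_const]. }
apply Clim_mult; [apply Clim_const |]; apply Clim_plus; [| apply Clim_mult; [apply Clim_const |]];
  apply (Clim_LogP F); try apply Clim_opp; try exact L; rewrite E; simpl; lra.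
Qed.

Lemma at_right_0_lt (d : R) : 0 < d -> at_right 0 (fun t => 0 < t < d).
Proof.
intros Hd; exists (mkposreal d Hd); intros t Ht H0; split; [exact H0 |].
change (Rabs (t - 0) < d) in Ht; rewrite Rminus_0_r in Ht.
generalize (Rle_abs t); lra.
Qed.

Lemma Clim_RtoC_at_right : Clim (at_right 0) (fun d : R => RtoC d) 0.
Proof. apply Clim_RtoC; intros P [e He]; exists e; intros y Hy _; apply He, Hy. Qed.

Lemma lower_estimate (r : nat) (R0 : R) : (2 <= r)%nat ->
  exists (c : R) (N0 : nat), forall N, (N0 <= N)%nat ->
  forall x : C, Im x < 0 -> Cmod (x / 2) <= R0 ->
  Cmod (Csum (multicos_term r (x / 2)) N - lower_exponent r x) <= c / INR N.
Proof.
intros Hr; destruct (tan_partial_fractions R0) as [c [N0 [Hc HPF]]].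
exists (2 * (R0 ^ r * c)), (S N0); intros N HN x Hx HR.
assert (PN : 0 < INR N) by (apply lt_0_INR; lia).
set (G := fun s : R => (Csum (multicos_term r (s * (x / 2))) N - lower_exponent r (s * x))%C).
assert (HK : 0 <= c / INR N) by (apply Rmult_le_pos; [exact Hc | apply Rlt_le, Rinv_0_lt_compat, PN]).
assert (HG : forall d, 0 < d <= 1 -> Cmod (G 1 - G d) <= 2 * (R0 ^ r * (c / INR N))).
{ intros d Hd; set (rho := Cmod (- Cexp (- (PI * Ci * (d * x))))).
  assert (Hrho : 0 <= rho < 1) by (split; [apply Cmod_ge_0 | apply Cmod_Cexp_lt1; lra]).
  set (F := fun (M : nat) (s : R) => (Csum (multicos_term r (s * (x / 2))) N -
             lower_exponent_with (fun k z => Li_part k z M) r (s * x))%C).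
  assert (LF : forall s, 0 < s -> Clim eventually (fun M => F M s) (G s)).
  { intros s Hs; apply Clim_minus; [apply Clim_const |].
    repeat first [apply Clim_minus | apply Clim_plus]; try apply Clim_const.
    apply Clim_mult; [apply Clim_const |]; apply Clim_sum; intros k _.
    apply Clim_mult; [apply Clim_mult; [apply Clim_const |] | apply Clim_const].
    apply Clim_Li_part, Cmod_Cexp_lt1; assumption. }
  (* With [d] fixed, [M] tends to infinity; the bound that remains is the same for all [d]. *)
  apply (Cmod_le_lim eventually (fun M => F M 1 - F M d)%C
    (fun M => 2 * (R0 ^ r * (c / INR N + 2 * PI * (rho ^ S M / (1 - rho)))))).
  - apply Clim_minus; apply LF; lra.
  - change (is_lim_seq (fun M => 2 * (R0 ^ r * (c / INR N + 2 * PI * (rho ^ S M / (1 - rho)))))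
      (2 * (R0 ^ r * (c / INR N)))).
    apply is_lim_seq_ext with (fun M => 2 * (R0 ^ r * (c / INR N)) +
      2 * R0 ^ r * (2 * PI) / (1 - rho) * rho ^ S M); [intros M; field; lra |].
    replace (Finite (2 * (R0 ^ r * (c / INR N)))) with
      (Finite (2 * (R0 ^ r * (c / INR N)) + 2 * R0 ^ r * (2 * PI) / (1 - rho) * 0))
      by (f_equal; ring).
    apply is_lim_seq_plus'; [apply is_lim_seq_const |].
    apply (is_lim_seq_scal_l _ _ (Finite 0)), is_lim_seq_pow_S, Hrho.
  - apply filter_forall; intros M.
    apply (increment_bound r N M x d R0 (c / INR N)); try assumption; try lia.
    intros z Hz Hz0; apply HPF; [lia | exact Hz | exact Hz0]. }
replace (Csum (multicos_term r (x / 2)) N - lower_exponent r x)%C with (G 1 - 0)%C.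
2: { unfold G; rewrite !Cmult_1_l; ring. }
replace (2 * (R0 ^ r * c) / INR N) with (2 * (R0 ^ r * (c / INR N))) by (field; lra).
(* Now [d] tends to 0, with [G d] rewritten through [boundary_exponent], which is continuous and
   vanishes there. *)
apply (Cmod_le_lim (at_right 0) (fun d => G 1 - G d)%C (fun _ => 2 * (R0 ^ r * (c / INR N)))).
- apply Clim_minus; [apply Clim_const |].
  assert (L0 := Clim_RtoC_at_right).
  assert (Ls : forall z : C, Clim (at_right 0) (fun d : R => (d * z)%C) 0).
  { intros z; assert (L := Clim_mult _ _ _ _ L0 (Clim_const z)).
    rewrite Cmult_0_l in L; exact L. }
  apply (Clim_ext_loc (fun d : R => Csum (multicos_term r (d * (x / 2))) N -
     boundary_exponent r (d * x))%C).
  { generalize (at_right_0_lt 1 Rlt_0_1); apply filter_imp; intros d Hd.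
    unfold G; rewrite lower_exponent_boundary; [reflexivity | lia |].
    destruct x; simpl in *; nra. }
  replace (RtoC 0) with (Csum (multicos_term r (0 / 2)) N - boundary_exponent r 0)%C.
  2: { rewrite boundary_exponent_0 by exact Hr.
       rewrite (Csum_ext _ (fun _ => 0 * 0)%C).
       - rewrite Csum_scal; ring.
       - intros k _; replace (0 / 2)%C with (RtoC 0) by (unfold Cdiv; ring).
         rewrite multicos_term_0; ring. }
  apply Clim_minus.
  + apply Clim_sum; intros k _; apply (Clim_multicos_term (at_right 0)); [lra |].
    replace (0 / 2)%C with (RtoC 0) by (unfold Cdiv; ring); apply Ls.
  + apply (Clim_boundary_exponent (at_right 0)); [| apply Ls |].
    * generalize (at_right_0_lt 1 Rlt_0_1); apply filter_imp; intros d Hd.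
      destruct x; simpl in *; nra.
    * replace (- (PI * Ci * 0))%C with (RtoC 0) by ring; rewrite Cexp_0; simpl; lra.
- apply filterlim_const.
- generalize (at_right_0_lt 1 Rlt_0_1); apply filter_imp; intros d Hd; apply HG; lra.
Qed.

Lemma filterlim_div_INR (c : R) : filterlim (fun N => c / INR N) eventually (locally 0).
Proof.
change (is_lim_seq (fun N => c * / INR N) 0).
replace (Finite 0) with (Rbar_mult c (Rbar_inv p_infty)) by (simpl; f_equal; ring).
apply is_lim_seq_scal_l, is_lim_seq_inv; [apply is_lim_seq_INR | discriminate].
Qed.

Lemma Clim_multicos_lower (r : nat) (x : C) : (2 <= r)%nat -> Im x < 0 ->
  Clim eventually (Csum (multicos_term r (x / 2))) (lower_exponent r x).
Proof.
intros Hr Hx; destruct (lower_estimate r (Cmod (x / 2)) Hr) as [c [N0 H]].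
apply (Clim_of_Cmod eventually _ _ (fun N => c / INR N)); [| apply filterlim_div_INR].
exists N0; intros N HN; apply H; [exact HN | exact Hx | right; reflexivity].
Qed.

Lemma Clim_multicos_real (r : nat) (x : R) : (2 <= r)%nat -> -1 < x < 1 ->
  Clim eventually (Csum (multicos_term r (x / 2)%C)) (boundary_exponent r x).
Proof.
(* Radius 2 covers the vertical approach [x - i d] with [0 < d < 1]: after halving, both coordinates
   are below 1 in absolute value. *)
intros Hr Hx; destruct (lower_estimate r 2 Hr) as [c [N0 H]].
apply (Clim_of_Cmod eventually _ _ (fun N => c / INR N)); [| apply filterlim_div_INR].
exists N0; intros N HN.
set (p := fun d : R => (x + d * (- Ci))%C).
assert (Lp : Clim (at_right 0) p x).
{ assert (L0 := Clim_RtoC_at_right).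
  assert (L := Clim_plus _ _ _ _ (Clim_const x) (Clim_mult _ _ _ _ L0 (Clim_const (- Ci)%C))).
  replace (x + 0 * - Ci)%C with (RtoC x) in L by ring; exact L. }
assert (Hp : forall d, 0 < d < 1 -> Im (p d) < 0).
{ intros d Hd; unfold p; simpl; lra. }
apply (Cmod_le_lim (at_right 0)
  (fun d => Csum (multicos_term r (p d / 2)%C) N - boundary_exponent r (p d))%C
  (fun _ => c / INR N)); [| apply filterlim_const |].
- apply Clim_minus.
  + apply Clim_sum; intros k _; apply (Clim_multicos_term (at_right 0)); [exact Hx |].
    apply Clim_mult; [exact Lp | apply Clim_const].
  + apply (Clim_boundary_exponent (at_right 0)); [| exact Lp |].
    * generalize (at_right_0_lt 1 Rlt_0_1); apply filter_imp; exact Hp.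
    (* Here [|x| < 1] keeps the logarithm off its cut: [1 + cos (pi x) = 2 cos (pi x / 2)^2] is
       positive. *)
    * replace (Re (1 + Cexp (- (PI * Ci * x)))) with (2 * cos (PI * x / 2) ^ 2).
      -- assert (0 < cos (PI * x / 2)); [| apply Rmult_lt_0_compat; [lra | apply pow_lt; assumption]].
         generalize PI_RGT_0; intros HP; apply cos_gt_0; nra.
      -- replace (- (PI * Ci * x))%C with (0, - (2 * (PI * x / 2))).
         2: { unfold Cmult, Copp, RtoC, Ci; simpl; f_equal; field. }
         simpl; rewrite exp_0, cos_neg, cos_2a_cos; ring.
- generalize (at_right_0_lt 1 Rlt_0_1); apply filter_imp; intros d Hd.
  rewrite <- lower_exponent_boundary by (lia || apply Hp, Hd).
  apply H; [exact HN | apply Hp, Hd |].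
  apply Rle_trans with (1 := Cmod_le_re_im _).
  replace (p d / 2)%C with (x / 2, - d / 2).
  2: { unfold p, Cdiv; rewrite <- RtoC_inv by lra.
       unfold Cmult, Cplus, RtoC, Ci, Copp; simpl; f_equal; field. }
  assert (B1 : Rabs (x / 2) < 1) by (apply Rabs_def1; lra).
  assert (B2 : Rabs (- d / 2) < 1) by (apply Rabs_def1; lra).
  simpl; lra.
Qed.

(** * Parity and the real axis *)

Lemma sign_sqr (n : nat) : (-1) ^ n * (-1) ^ n = 1.
Proof. rewrite <- Rpow_mult_distr; replace (-1 * -1) with 1 by ring; apply pow1. Qed.

Lemma Cpow_opp (z : C) (n : nat) : ((- z) ^ n)%C = (((-1) ^ n)%R * z ^ n)%C.
Proof.
replace (- z)%C with (RtoC (-1) * z)%C by ring; rewrite Cpow_mult_l, <- RtoC_pow; reflexivity.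
Qed.

Lemma multicos_term_opp (r m : nat) (z : C) :
  multicos_term r (- z) m = (((-1) ^ (r - 1))%R * multicos_term r z m)%C.
Proof.
unfold multicos_term; set (e := (-1) ^ (r - 1)).
assert (E : (RtoC e * RtoC e)%C = 1) by (rewrite <- RtoC_mult; f_equal; apply sign_sqr).
replace (2 * - z / INR (2 * m + 1))%C with (- (2 * z / INR (2 * m + 1)))%C
  by (unfold Cdiv; ring).
set (y := (2 * z / INR (2 * m + 1))%C); replace (- - y)%C with y by ring.
transitivity ((half_odd m ^ (r - 1))%R * (e * LogP r y + (e * e) * LogP r (- y)))%C; [| ring].
rewrite E; ring.
Qed.

Lemma Clim_multicos_upper (r : nat) (x : C) : (2 <= r)%nat -> 0 < Im x ->
  Clim eventually (Csum (multicos_term r (x / 2)))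
    (((-1) ^ (r - 1))%R * lower_exponent r (- x))%C.
Proof.
intros Hr Hx.
apply (Clim_ext (fun N => ((-1) ^ (r - 1))%R * Csum (multicos_term r (- x / 2)) N)%C).
- intros N; rewrite <- Csum_scal; apply Csum_ext; intros k _.
  replace (x / 2)%C with (- (- x / 2))%C by (unfold Cdiv; ring).
  rewrite multicos_term_opp; reflexivity.
- apply Clim_mult; [apply Clim_const |]; apply Clim_multicos_lower; [exact Hr |].
  simpl; unfold Im in Hx; lra.
Qed.

(** The sign [(-1)^(r-1)] is its own inverse and is absorbed by [(2 pi i)^(r-1)]; [(-1)^k] moves
    from [(- x)^k] to [(pi i)^k]; the monomial has degree [r], so one sign is left over. *)
Lemma upper_exponent (r : nat) (x : C) : (1 <= r)%nat ->
  (((-1) ^ (r - 1))%R * lower_exponent r (- x))%C =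
  (- (INR (fact (r - 1)) / (- (2 * PI * Ci)) ^ (r - 1))
     * Csum (fun k => (- (PI * Ci)) ^ k / INR (fact k)
                      * Li (r - k) (- Cexp (PI * Ci * x)) * x ^ k) r
   - PI * Ci / INR r * (x / 2) ^ r
   - INR (fact (r - 1)) / (- (2 * PI * Ci)) ^ (r - 1) * zetaE r)%C.
Proof.
intros Hr; unfold lower_exponent, lower_exponent_with, coef.
rewrite (Csum_ext (fun k => (- (PI * Ci)) ^ k / INR (fact k) * _ * _)%C
  (fun k => (PI * Ci) ^ k / INR (fact k) * Li (r - k) (- Cexp (- (PI * Ci * - x))) * (- x) ^ k)%C).
2: { intros k _; replace (- (PI * Ci * - x))%C with (PI * Ci * x)%C by ring.
     rewrite !Cpow_opp; unfold Cdiv; ring. }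
set (S := Csum _ r).
replace (- x / 2)%C with (- (x / 2))%C by (unfold Cdiv; ring).
rewrite !Cpow_opp.
assert (E1 : RtoC ((-1) ^ r) = (- RtoC ((-1) ^ (r - 1)))%C).
{ rewrite <- RtoC_opp; f_equal; replace r with (Datatypes.S (r - 1)) at 1 by lia; simpl; ring. }
rewrite E1.
assert (E2 := f_equal RtoC (sign_sqr (r - 1))); rewrite RtoC_mult in E2.
set (e := RtoC ((-1) ^ (r - 1))) in *.
assert (Ne : e <> 0) by (intros E; rewrite E, Cmult_0_l in E2; apply RtoC_inj in E2; lra).
set (b := ((2 * PI * Ci) ^ (r - 1))%C).
assert (Nb : b <> 0) by (apply Cpow_nz, two_PI_Ci_neq0).
(* [field] cannot use [e * e = 1], so the square is inserted by hand where the two sides differ by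
   it. *)
replace (INR (fact (r - 1)) / (e * b))%C with (e * e * (INR (fact (r - 1)) / (e * b)))%C
  by (rewrite E2; ring).
replace (PI * Ci / INR r * (x / 2) ^ r)%C with (e * e * (PI * Ci / INR r * (x / 2) ^ r))%C
  by (rewrite E2; ring).
field; repeat split; try assumption; apply RtoC_neq0, not_0_INR; lia.
Qed.

Lemma Im_Csum_real (f : nat -> C) (n : nat) :
  (forall k, (k < n)%nat -> Im (f k) = 0) -> Im (Csum f n) = 0.
Proof.
induction n as [|n IH]; intros H; [reflexivity |].
change (Im (Csum f n) + Im (f n) = 0); rewrite IH, H by auto with arith; ring.
Qed.

Lemma Im_LogP_real (r : nat) (y : R) : y < 1 -> Im (LogP r y) = 0.
Proof.
intros Hy; unfold LogP.
change (Im (CLog (1 - y)) + Im (Csum (fun j => y ^ S j / INR (S j))%C r) = 0).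
rewrite Im_Csum_real.
- rewrite <- RtoC_minus; unfold CLog; rewrite Carg_re_pos by (simpl; lra).
  simpl; unfold Rdiv; rewrite Rmult_0_l, atan_0; ring.
- intros k _; rewrite <- RtoC_pow; unfold Cdiv.
  rewrite <- RtoC_inv by (apply not_0_INR; lia); rewrite <- RtoC_mult; reflexivity.
Qed.

Lemma Im_multicos_term_real (r m : nat) (x : R) : -1 < x < 1 ->
  Im (multicos_term r (x / 2)%C m) = 0.
Proof.
intros Hx; assert (Ha : / 2 <= half_odd m) by (rewrite half_odd_eq; generalize (pos_INR m); lra).
unfold multicos_term; rewrite half_odd_div.
assert (P := inv_half_odd_le m).
replace (x / 2 / half_odd m)%C with (RtoC (x / 2 * / half_odd m))
  by (unfold Cdiv, Rdiv; rewrite !RtoC_mult, !RtoC_inv by lra; reflexivity).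
rewrite <- RtoC_opp.
assert (I1 := Im_LogP_real r (x / 2 * / half_odd m) ltac:(nra)).
assert (I2 := Im_LogP_real r (- (x / 2 * / half_odd m)) ltac:(nra)).
assert (G : forall (a e : R) (u v : C), Im (a * (u + e * v)) = a * (Im u + e * Im v))
  by (intros; simpl; unfold Im; ring).
rewrite G, I1, I2; ring.
Qed.

(** Not apparent from the closed form: it is the limit of partial sums whose terms are all real.
    Hence taking real parts loses nothing. *)
Lemma Im_boundary_exponent (r : nat) (x : R) : (2 <= r)%nat -> -1 < x < 1 ->
  Im (boundary_exponent r x) = 0.
Proof.
intros Hr Hx.
apply (filterlim_locally_unique (F := eventually)
  (fun N => Im (Csum (multicos_term r (x / 2)%C) N))).
- apply Clim_multicos_real; assumption.
- apply (filterlim_ext (fun _ => 0)); [| apply filterlim_const].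
  intros N; rewrite Im_Csum_real; [reflexivity |].
  intros k _; apply Im_multicos_term_real, Hx.
Qed.

Lemma multicos_real (r : nat) (x : R) : (2 <= r)%nat -> -1 < x < 1 ->
  multicos r (RtoC (x / 2)) = RtoC (exp (Re (boundary_exponent r x))).
Proof.
intros Hr Hx; rewrite multicosE.
replace (RtoC (x / 2)) with (x / 2)%C
  by (unfold Rdiv; rewrite RtoC_mult, RtoC_inv by lra; reflexivity).
rewrite (CSeries_unique _ _ (Clim_multicos_real r x Hr Hx)).
unfold Cexp; rewrite Im_boundary_exponent, cos_0, sin_0 by assumption.
rewrite Rmult_1_r, Rmult_0_r; reflexivity.
Qed.

(** [CSeries] is componentwise, so this is an identity of terms with no convergence involved. *)
Lemma Li_unit_circle (k : nat) (x : R) :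
  Li k (- Cexp (- (PI * Ci * x))) =
  (Series (fun n => (-1) ^ S n * cos (PI * INR (S n) * x) / INR (S n) ^ k),
   - Series (fun n => (-1) ^ S n * sin (PI * INR (S n) * x) / INR (S n) ^ k)).
Proof.
rewrite LiE; unfold CSeries; rewrite <- Series_opp.
assert (E : forall n, ((- Cexp (- (PI * Ci * x))) ^ S n / (INR (S n) ^ k)%R)%C =
  ((-1) ^ S n * cos (PI * INR (S n) * x) / INR (S n) ^ k,
   - ((-1) ^ S n * sin (PI * INR (S n) * x) / INR (S n) ^ k))).
{ intros n; rewrite Cpow_opp; change Complex.Cpow with Defs.Cpow; rewrite Cpow_Cexp.
  unfold Cdiv; rewrite <- RtoC_inv by (apply pow_nonzero, not_0_INR; lia).
  replace (INR (S n) * - (PI * Ci * x))%C with (0, - (PI * INR (S n) * x)).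
  2: { unfold Cmult, Copp, RtoC, Ci; cbn [fst snd]; f_equal; ring. }
  unfold Cexp, Re, Im, Cmult, RtoC; cbn [fst snd].
  rewrite exp_0, cos_neg, sin_neg; f_equal; unfold Rdiv; ring. }
f_equal; apply Series_ext; intros n; rewrite E; reflexivity.
Qed.

(** * Real parts through powers of [- Ci] *)

Lemma Ci_pow_cancel (k : nat) : ((- Ci) ^ k * Ci ^ k)%C = 1.
Proof.
rewrite <- Cpow_mult_l; replace (- Ci * Ci)%C with (RtoC 1); [apply Cpow_1_l |].
unfold Cmult, Copp, Ci, RtoC; simpl; f_equal; ring.
Qed.

Lemma coef_eq (r : nat) :
  coef r = (RtoC (INR (fact (r - 1)) / (2 * PI) ^ (r - 1)) * (- Ci) ^ (r - 1))%C.
Proof.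
assert (HP := PI_RGT_0).
assert (N : (2 * PI) ^ (r - 1) <> 0) by (apply pow_nonzero; lra).
unfold coef; rewrite Cpow_mult_l.
assert (E := Ci_pow_cancel (r - 1)).
assert (NI : (Ci ^ (r - 1))%C <> 0).
{ intros E0; rewrite E0, Cmult_0_r in E; apply RtoC_inj in E; lra. }
unfold Rdiv; rewrite RtoC_mult, RtoC_inv by exact N.
rewrite RtoC_pow, RtoC_mult.
assert (N2 : ((2 * PI) ^ (r - 1))%C <> 0)
  by (apply Cpow_nz; rewrite <- RtoC_mult; apply RtoC_neq0; lra).
replace ((- Ci) ^ (r - 1))%C with (/ Ci ^ (r - 1))%C; [field; split; assumption |].
replace (/ Ci ^ (r - 1))%C with ((- Ci) ^ (r - 1) * Ci ^ (r - 1) * / Ci ^ (r - 1))%C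
  by (rewrite E; ring).
field; exact NI.
Qed.

(** The [i^k] in [(pi i)^k] cancels [k] of the [r - 1] factors [- i]. The parity of the remaining
    exponent decides whether the cosine or the sine series has a real contribution. *)
Lemma coef_term (r k : nat) (x : R) (L : C) : (k < r)%nat ->
  (coef r * ((PI * Ci) ^ k / INR (fact k) * L * x ^ k))%C =
  (RtoC (INR (fact (r - 1)) / (2 * PI) ^ (r - 1) * ((PI * x) ^ k / INR (fact k))) *
   ((- Ci) ^ (r - 1 - k) * L))%C.
Proof.
intros Hk; rewrite coef_eq.
replace (r - 1)%nat with (r - 1 - k + k)%nat at 3 by lia.
rewrite Cpow_add_r, !Cpow_mult_l, RtoC_mult.
assert (N := INR_fact_neq_0 k).
replace (RtoC ((PI * x) ^ k / INR (fact k))) with (PI ^ k * x ^ k / INR (fact k))%C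
  by (unfold Rdiv; rewrite RtoC_mult, RtoC_inv, RtoC_pow, RtoC_mult, Cpow_mult_l by exact N;
      reflexivity).
transitivity (RtoC (INR (fact (r - 1)) / (2 * PI) ^ (r - 1)) * (PI ^ k * x ^ k / INR (fact k)) *
  ((- Ci) ^ (r - 1 - k) * L) * ((- Ci) ^ k * Ci ^ k))%C.
- field; apply RtoC_neq0, N.
- rewrite Ci_pow_cancel; ring.
Qed.

Lemma opp_Ci_pow (e : nat) :
  ((- Ci) ^ (2 * e))%C = RtoC ((-1) ^ e) /\ ((- Ci) ^ (2 * e + 1))%C = (0, - (-1) ^ e).
Proof.
assert (E : ((- Ci) ^ (2 * e))%C = RtoC ((-1) ^ e)).
{ rewrite Cpow_mult_r.
  replace ((- Ci) ^ 2)%C with (RtoC (-1)); [symmetry; apply RtoC_pow |].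
  unfold Cpow, Cmult, Copp, Ci, RtoC; simpl; f_equal; ring. }
split; [exact E |]; rewrite Cpow_add_r, E.
unfold Cpow, Cmult, Copp, Ci, RtoC; simpl; f_equal; ring.
Qed.

Lemma Re_Csum (f : nat -> C) (n : nat) : Re (Csum f n) = Rsum (fun k => Re (f k)) n.
Proof.
induction n as [|n IH]; [reflexivity |].
change (Re (Csum f n) + Re (f n) = Rsum (fun k => Re (f k)) (S n)); rewrite IH; reflexivity.
Qed.

Lemma Rsum_lin (u g h : nat -> R) (a b : R) (n : nat) :
  (forall k, (k < n)%nat -> u k = a * g k + b * h k) ->
  Rsum u n = a * Rsum g n + b * Rsum h n.
Proof.
induction n as [|n IH]; intros H; simpl; [ring |].
rewrite IH, H by auto with arith; ring.
Qed.

(** Origin of the power of the cosine: the real part of the boundary logarithm is [ln] of this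
    modulus. *)
Lemma Cmod_one_plus_Cexp (x : R) : 0 <= x < 1 ->
  Cmod (1 + Cexp (- (PI * Ci * x))) = 2 * cos (PI * x / 2).
Proof.
intros Hx.
assert (P : 0 < cos (PI * x / 2)) by (generalize PI_RGT_0; intros HP; apply cos_gt_0; nra).
replace (- (PI * Ci * x))%C with (0, - (2 * (PI * x / 2))).
2: { unfold Cmult, Copp, RtoC, Ci; simpl; f_equal; field. }
unfold Cmod, Cexp; simpl; rewrite exp_0, cos_neg, sin_neg, cos_2a_cos, sin_2a.
transitivity (sqrt ((2 * cos (PI * x / 2)) ^ 2)); [f_equal | apply sqrt_pow2; lra].
generalize (sin2_cos2 (PI * x / 2)); unfold Rsqr; intros E.
set (c := cos _) in *; set (s := sin _) in *.
assert (Es : s * s = 1 - c * c) by lra.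
transitivity (4 * (c * c) * (s * s) + 4 * (c * c) * (c * c)); [ring | rewrite Es; ring].
Qed.

(** For [k = r - 1] no factor [- i] is left and the constants reduce to [(x / 2)^(r-1)], so only the
    real part of the logarithm enters. The monomial is purely imaginary and drops out. *)
Lemma Re_boundary_exponent (r : nat) (x : R) : (2 <= r)%nat -> 0 <= x < 1 ->
  Re (boundary_exponent r x) =
  (x / 2) ^ (r - 1) * ln (2 * cos (PI * x / 2))
  - Rsum (fun k => INR (fact (r - 1)) / (2 * PI) ^ (r - 1) * ((PI * x) ^ k / INR (fact k)) *
       Re ((- Ci) ^ (r - 1 - k) * Li (r - k) (- Cexp (- (PI * Ci * x))))) (r - 1)
  - INR (fact (r - 1)) / (2 * PI) ^ (r - 1) * zetaE r * Re ((- Ci) ^ (r - 1)).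
Proof.
intros Hr Hx; unfold boundary_exponent.
set (l := CLog (1 + Cexp (- (PI * Ci * x)))).
set (u := fun k => ((PI * Ci) ^ k / INR (fact k) * Li (r - k) (- Cexp (- (PI * Ci * x))) * x ^ k)%C).
assert (N := INR_fact_neq_0 (r - 1)).
assert (NP : (2 * PI) ^ (r - 1) <> 0) by (apply pow_nonzero; generalize PI_RGT_0; lra).
replace (- coef r * (Csum u (r - 1) -
     (PI * Ci) ^ (r - 1) / INR (fact (r - 1)) * l * x ^ (r - 1))
   + PI * Ci / INR r * (x / 2) ^ r - coef r * zetaE r)%C
 with (RtoC ((x / 2) ^ (r - 1)) * l - Csum (fun k => coef r * u k) (r - 1)
   + RtoC (PI / INR r * (x / 2) ^ r) * Ci
   - RtoC (INR (fact (r - 1)) / (2 * PI) ^ (r - 1) * zetaE r) * (- Ci) ^ (r - 1))%C.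
2: { rewrite Csum_scal.
     assert (T := coef_term r (r - 1) x l ltac:(lia)); rewrite Nat.sub_diag in T.
     replace (INR (fact (r - 1)) / (2 * PI) ^ (r - 1) * ((PI * x) ^ (r - 1) / INR (fact (r - 1))))
       with ((x / 2) ^ (r - 1)) in T.
     2: { replace (PI * x) with (2 * PI * (x / 2)) by field.
          rewrite (Rpow_mult_distr (2 * PI)); field; split; assumption. }
     replace (RtoC ((x / 2) ^ (r - 1)) * l)%C
       with (coef r * ((PI * Ci) ^ (r - 1) / INR (fact (r - 1)) * l * x ^ (r - 1)))%C
       by (rewrite T; simpl Cpow; ring).
     rewrite (RtoC_mult _ (zetaE r)).
     replace (RtoC (INR (fact (r - 1)) / (2 * PI) ^ (r - 1)) * zetaE r * (- Ci) ^ (r - 1))%C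
       with (coef r * zetaE r)%C by (rewrite coef_eq; ring).
     assert (NR : INR r <> 0) by (apply not_0_INR; lia).
     replace (RtoC (PI / INR r * (x / 2) ^ r)) with (PI / INR r * (x / 2) ^ r)%C
       by (unfold Rdiv; rewrite !RtoC_mult, RtoC_inv, RtoC_pow, RtoC_mult, RtoC_inv
             by (lra || exact NR); reflexivity).
     unfold Cdiv; ring. }
assert (Rs : forall (a : R) (z : C), Re (a * z) = a * Re z) by (intros a [z1 z2]; simpl; ring).
assert (Rm : forall a b : C, Re (a - b) = Re a - Re b) by (intros a b; reflexivity).
assert (Rp : forall a b : C, Re (a + b) = Re a + Re b) by (intros a b; reflexivity).
rewrite Rm, Rp, Rm, !Rs, Re_Csum.
replace (Re l) with (ln (2 * cos (PI * x / 2))).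
2: { unfold l; simpl; rewrite Cmod_one_plus_Cexp by exact Hx; reflexivity. }
replace (Re Ci) with 0 by reflexivity.
rewrite (Rsum_lin (fun k => Re (coef r * u k))
  (fun k => INR (fact (r - 1)) / (2 * PI) ^ (r - 1) * ((PI * x) ^ k / INR (fact k)) *
     Re ((- Ci) ^ (r - 1 - k) * Li (r - k) (- Cexp (- (PI * Ci * x))))) (fun _ => 0) 1 0).
- ring.
- intros k Hk; rewrite Rmult_0_r, Rplus_0_r, Rmult_1_l; unfold u.
  rewrite coef_term by lia; apply Rs.
Qed.

Lemma Re_Ci_pow_even (e : nat) (c s : R) : Re ((- Ci) ^ (2 * e) * (c, (- s)%R))%C = (-1) ^ e * c.
Proof. rewrite (proj1 (opp_Ci_pow e)); simpl; ring. Qed.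

Lemma Re_Ci_pow_odd (e : nat) (c s : R) : Re ((- Ci) ^ (2 * e + 1) * (c, (- s)%R))%C = - (-1) ^ e * s.
Proof. rewrite (proj2 (opp_Ci_pow e)); simpl; ring. Qed.

Lemma sign_sub (p q : nat) : (q <= p)%nat -> (-1) ^ (p - q) = (-1) ^ p * (-1) ^ q.
Proof.
intros H; replace p with (p - q + q)%nat at 2 by lia.
rewrite pow_add, Rmult_assoc, sign_sqr; ring.
Qed.

Theorem theorem2p11 (r : nat) (hr : (2 <= r)%nat) :
  (* (1) Im x < 0 *)
  (forall x : C, Im x < 0 ->
     multicos r (x / 2)%C =
     Cexp (- (INR (fact (r - 1)) / Cpow (2 * PI * Ci) (r - 1))
             * Csum (fun k => Cpow (PI * Ci) k / INR (fact k)
                              * Li (r - k) (- Cexp (- (PI * Ci * x)))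
                              * Cpow x k) r
           + PI * Ci / INR r * Cpow (x / 2) r
           - INR (fact (r - 1)) / Cpow (2 * PI * Ci) (r - 1) * zetaE r)%C) /\
  (* (2) Im x > 0 *)
  (forall x : C, 0 < Im x ->
     multicos r (x / 2)%C =
     Cexp (- (INR (fact (r - 1)) / Cpow (- (2 * PI * Ci)) (r - 1))
             * Csum (fun k => Cpow (- (PI * Ci)) k / INR (fact k)
                              * Li (r - k) (- Cexp (PI * Ci * x))
                              * Cpow x k) r
           - PI * Ci / INR r * Cpow (x / 2) r
           - INR (fact (r - 1)) / Cpow (- (2 * PI * Ci)) (r - 1) * zetaE r)%C) /\
  (* (3) r even, 0 <= x < 1 real *)
  (Nat.even r = true -> forall x : R, 0 <= x < 1 ->
     multicos r (RtoC (x / 2)) =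
     RtoC (Rpower (2 * cos (PI * x / 2)) ((x / 2) ^ (r - 1)) *
       exp ((-1) ^ (r / 2) * INR (fact (r - 1)) / (2 * PI) ^ (r - 1)
              * Rsum (fun k => if andb (Nat.odd k) (k + 3 <=? r)%nat then
                         (-1) ^ ((k - 1) / 2) * (PI * x) ^ k / INR (fact k)
                         * Series (fun n => (-1) ^ (S n) * cos (PI * INR (S n) * x)
                                            / INR (S n) ^ (r - k))
                       else 0) r
            - (-1) ^ (r / 2) * INR (fact (r - 1)) / (2 * PI) ^ (r - 1)
              * Rsum (fun k => if andb (Nat.even k) (k + 2 <=? r)%nat then
                         (-1) ^ (k / 2) * (PI * x) ^ k / INR (fact k)
                         * Series (fun n => (-1) ^ (S n) * sin (PI * INR (S n) * x)
                                            / INR (S n) ^ (r - k))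
                       else 0) r))) /\
  (* (4) r >= 3 odd, 0 <= x < 1 real *)
  (Nat.odd r = true -> (3 <= r)%nat -> forall x : R, 0 <= x < 1 ->
     multicos r (RtoC (x / 2)) =
     RtoC (Rpower (2 * cos (PI * x / 2)) ((x / 2) ^ (r - 1)) *
       exp (- ((-1) ^ ((r - 1) / 2) * INR (fact (r - 1)) / (2 * PI) ^ (r - 1)
              * Rsum (fun k => if andb (Nat.even k) (k + 3 <=? r)%nat then
                         (-1) ^ (k / 2) * (PI * x) ^ k / INR (fact k)
                         * Series (fun n => (-1) ^ (S n) * cos (PI * INR (S n) * x)
                                            / INR (S n) ^ (r - k))
                       else 0) r)
            - (-1) ^ ((r - 1) / 2) * INR (fact (r - 1)) / (2 * PI) ^ (r - 1)
              * Rsum (fun k => if andb (Nat.odd k) (k + 2 <=? r)%nat then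
                         (-1) ^ ((k - 1) / 2) * (PI * x) ^ k / INR (fact k)
                         * Series (fun n => (-1) ^ (S n) * sin (PI * INR (S n) * x)
                                            / INR (S n) ^ (r - k))
                       else 0) r
            - (-1) ^ ((r - 1) / 2) * INR (fact (r - 1)) / (2 * PI) ^ (r - 1)
              * zetaE r))).

Proof.
split; [| split; [| split]].
- intros x Hx; rewrite multicosE, (CSeries_unique _ _ (Clim_multicos_lower r x hr Hx)).
  reflexivity.
- intros x Hx; rewrite multicosE, (CSeries_unique _ _ (Clim_multicos_upper r x hr Hx)).
  rewrite upper_exponent by lia; reflexivity.
- intros He x Hx; apply Nat.even_spec in He; destruct He as [p Hp].
  rewrite (multicos_real r x hr ltac:(lra)), Re_boundary_exponent by assumption.
  unfold Rpower; rewrite <- exp_plus; do 2 f_equal.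
  match goal with |- _ = _ + (?a * Rsum ?g r - _ * Rsum ?h r) =>
    set (A := a); set (G := g); set (H := h) end.
  (* The guards exclude [k = r - 1], so the range agrees with that of [Re_boundary_exponent]. *)
  replace (Rsum G r) with (Rsum G (r - 1)).
  2: { replace r with (S (r - 1)) at 2 by lia; simpl; unfold G at 3.
       replace (r - 1 + 3 <=? r)%nat with false by (symmetry; apply Nat.leb_gt; lia).
       rewrite Bool.andb_false_r; ring. }
  replace (Rsum H r) with (Rsum H (r - 1)).
  2: { replace r with (S (r - 1)) at 2 by lia; simpl; unfold H at 3.
       replace (r - 1 + 2 <=? r)%nat with false by (symmetry; apply Nat.leb_gt; lia).
       rewrite Bool.andb_false_r; ring. }
  (* For even [r] this power is imaginary, which is why (3) has no zeta term. *)
  replace (Re ((- Ci) ^ (r - 1))) with 0.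
  2: { replace (r - 1)%nat with (2 * (p - 1) + 1)%nat by lia.
       rewrite (proj2 (opp_Ci_pow _)); reflexivity. }
  (* The single sum over [k] splits by parity into cosine and sine sums; their opposite signs come
     from [(- i)^2 = -1]. *)
  rewrite (Rsum_lin _ G H (- A) A); [ring |].
  intros k Hk; rewrite Li_unit_circle; unfold A, G, H.
  replace (r / 2)%nat with p by (rewrite Hp, Nat.mul_comm, Nat.div_mul; lia).
  destruct (Nat.Even_or_Odd k) as [[q Hq]|[q Hq]].
  + replace (Nat.even k) with true by (rewrite Hq, Nat.even_even; reflexivity).
    replace (Nat.odd k) with false by (rewrite Hq, Nat.odd_even; reflexivity).
    replace (k + 2 <=? r)%nat with true by (symmetry; apply Nat.leb_le; lia).
    cbn [andb].
    replace (k / 2)%nat with q by (rewrite Hq, Nat.mul_comm, Nat.div_mul; lia).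
    (* An odd power of [- i] picks out the sine series. *)
    replace (r - 1 - k)%nat with (2 * (p - S q) + 1)%nat by lia.
    rewrite Re_Ci_pow_odd, sign_sub by lia; simpl pow; unfold Rdiv; ring.
  + replace (Nat.odd k) with true by (rewrite Hq, Nat.odd_odd; reflexivity).
    replace (Nat.even k) with false by (rewrite Hq, Nat.even_odd; reflexivity).
    (* With [k] odd and [r] even, [k < r - 1] already forces [k <= r - 3]. *)
    replace (k + 3 <=? r)%nat with true by (symmetry; apply Nat.leb_le; lia).
    cbn [andb].
    replace ((k - 1) / 2)%nat with q
      by (rewrite Hq, Nat.add_sub, Nat.mul_comm, Nat.div_mul; lia).
    replace (r - 1 - k)%nat with (2 * (p - S q))%nat by lia.
    rewrite Re_Ci_pow_even, sign_sub by lia; simpl pow; unfold Rdiv; ring.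
- intros Ho Hr3 x Hx; apply Nat.odd_spec in Ho; destruct Ho as [p Hp].
  rewrite (multicos_real r x hr ltac:(lra)), Re_boundary_exponent by assumption.
  unfold Rpower; rewrite <- exp_plus; do 2 f_equal.
  match goal with |- _ = _ + (- (?a * Rsum ?g r) - _ * Rsum ?h r - _) =>
    set (A := a); set (G := g); set (H := h) end.
  replace (Rsum G r) with (Rsum G (r - 1)).
  2: { replace r with (S (r - 1)) at 2 by lia; simpl; unfold G at 3.
       replace (r - 1 + 3 <=? r)%nat with false by (symmetry; apply Nat.leb_gt; lia).
       rewrite Bool.andb_false_r; ring. }
  replace (Rsum H r) with (Rsum H (r - 1)).
  2: { replace r with (S (r - 1)) at 2 by lia; simpl; unfold H at 3.
       replace (r - 1 + 2 <=? r)%nat with false by (symmetry; apply Nat.leb_gt; lia).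
       rewrite Bool.andb_false_r; ring. }
  assert (Hp2 : ((r - 1) / 2)%nat = p)
    by (rewrite Hp, Nat.add_sub, Nat.mul_comm, Nat.div_mul; lia).
  (* For odd [r] the power is real, and the zeta term survives with this sign. *)
  replace (Re ((- Ci) ^ (r - 1))) with ((-1) ^ p).
  2: { replace (r - 1)%nat with (2 * p)%nat by lia.
       rewrite (proj1 (opp_Ci_pow _)); reflexivity. }
  rewrite (Rsum_lin _ G H A A); [unfold A; rewrite Hp2; unfold Rdiv; ring |].
  intros k Hk; rewrite Li_unit_circle; unfold A, G, H; rewrite Hp2.
  destruct (Nat.Even_or_Odd k) as [[q Hq]|[q Hq]].
  + replace (Nat.even k) with true by (rewrite Hq, Nat.even_even; reflexivity).
    replace (Nat.odd k) with false by (rewrite Hq, Nat.odd_even; reflexivity).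
    replace (k + 3 <=? r)%nat with true by (symmetry; apply Nat.leb_le; lia).
    cbn [andb].
    replace (k / 2)%nat with q by (rewrite Hq, Nat.mul_comm, Nat.div_mul; lia).
    replace (r - 1 - k)%nat with (2 * (p - q))%nat by lia.
    rewrite Re_Ci_pow_even, sign_sub by lia; unfold Rdiv; ring.
  + replace (Nat.odd k) with true by (rewrite Hq, Nat.odd_odd; reflexivity).
    replace (Nat.even k) with false by (rewrite Hq, Nat.even_odd; reflexivity).
    replace (k + 2 <=? r)%nat with true by (symmetry; apply Nat.leb_le; lia).
    cbn [andb].
    replace ((k - 1) / 2)%nat with q
      by (rewrite Hq, Nat.add_sub, Nat.mul_comm, Nat.div_mul; lia).
    replace (r - 1 - k)%nat with (2 * (p - S q) + 1)%nat by lia.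
    rewrite Re_Ci_pow_odd, sign_sub by lia; simpl pow; unfold Rdiv; ring.
Qed.
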